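(* For any degree $d$ and graph length $L$ and any algorithm, there exists an instance of the linear causal bandit problem with model deviations of budget $C$ (as described in the context) such that the expected regret is at least $$\mathbb{E}[R(T)]\;\ge\;\Omega\Big(d^{\frac L2-2}\max\{\sqrt T,\;d^2C\}\Big).$$
   Context: Causal model. $\mathcal{G}=([N],\mathcal{E})$ is a known directed acyclic graph; $\mathrm{pa}(i)$ is the set of parents of node $i$, the degree $d=\max_i|\mathrm{pa}(i)|$ is the maximum in-degree, and the graph length $L$ is the length of the longest directed path. $[A]_i$ denotes the $i$-th column of a matrix $A$; $\|\cdot\|$ is the Euclidean norm. The nominal model is a linear structural equation model $X=B^\top X+\epsilon$, where $B\in\mathbb{R}^{N\times N}$ is a strictly upper triangular edge-weight matrix of the graph, unknown to the learner, and $\epsilon$ is the vector of exogenous noise variables, with known mean $\nu=\mathbb{E}[\epsilon]$, $1$-sub-Gaussian, with $\|\epsilon\|\le m_\epsilon$. A (soft) intervention on node $i$ changes the column $[B]_i$ to $[B^*]_i$, where $B^*$ is the interventional weight matrix, also unknown. An intervention is any $a\in\mathcal{A}=2^{[N]}$, with nominal weight matrix $B_a$ given by $[B_a]_i=[B]_i$ if $i\notin a$ and $[B_a]_i=[B^*]_i$ if $i\in a$; it is assumed that $\|[B_a]_i\|\le1$. There is a constant $m$ with $\|X\|\le m$. Model deviations. The graph structure is fixed, but at time $t$ the actual unknown weight matrix is $D_{a(t)}$ instead of the nominal $B_{a(t)}$, where $a(t)$ is the intervention selected by the algorithm at time $t$; the deviation is $\Delta_{a(t)}=D_{a(t)}-B_{a(t)}$.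 The data $X(t)=(X_1(t),\dots,X_N(t))^\top$ observed at time $t$ are generated by the linear model with weight matrix $D_{a(t)}$. Deviation budget over the horizon $T$. $C$ denotes either $C=m_c\,C_{\rm DF}$, where $C_{\rm DF}=\max_{i\in[N]}\sum_{t=1}^T\max_{a(t)\in\mathcal{A}}\mathbb{1}\{\|[\Delta_{a(t)}]_i\|\ne0\}$ and $\|[\Delta_{a(t)}]_i\|\le m_c$ for all $i,t,a(t)$ with a constant $m_c$; or $C=C_{\rm AD}=\max_{i\in[N]}\sum_{t=1}^T\max_{a(t)\in\mathcal{A}}\|[\Delta_{a(t)}]_i\|$. $C$ is known to the learner. Regret. Node $N$ (which has no descendant) is the reward node. $\mu_a=\mathbb{E}_a[X_N]$ is the expected reward under intervention $a$ with weight matrix $B_a$. With $a^*=\arg\max_{a\in\mathcal{A}}\mu_a$, $\mathbb{E}[R(T)]=T\mu_{a^*}-\sum_{t=1}^T\mathbb{E}[X_N(t)]$. *)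

(* Defs.v *)
From HB Require Import structures.
From mathcomp Require Import all_boot all_order all_algebra.
From mathcomp Require Import all_classical all_reals all_analysis.

Set Implicit Arguments.
Unset Strict Implicit.
Unset Printing Implicit Defensive.

Import Order.TTheory GRing.Theory Num.Theory.
Import numFieldNormedType.Exports.
Local Open Scope classical_set_scope.
Local Open Scope ring_scope.

(** Nodes are the elements of ['I_n.+1]; [ord_max] is the reward node.
    Random vectors are tuples, as these carry the product sigma-algebra. *)

Section Euclidean_norm.
Variable R : realType.

(* The library norm on matrices is the sup norm. *)
Definition norm2 n (v : 'cV[R]_n) : R := Num.sqrt (\sum_i v i 0 ^+ 2).

Definition cvec n (x : n.-tuple R) : 'cV[R]_n := \col_i tnth x i.

End Euclidean_norm.

Section Graphs.
Variable n : nat.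
Implicit Type e : rel 'I_n.+1.

(* Acyclicity, in the form of a topological ordering of the nodes. *)
Definition topological e := forall i j, e i j -> (i < j)%N.

Definition parents e (j : 'I_n.+1) : {set 'I_n.+1} := [set i | e i j]%SET.

Definition degree e : nat := \max_(j < n.+1) #|parents e j|.

(* [path e i p] is a directed path with [size p] edges. *)
Definition has_length e (L : nat) :=
  (exists i p, path e i p /\ size p = L) /\
  (forall i p, path e i p -> (size p <= L)%N).

End Graphs.

Section Linear_SEM.
Variables (R : realType) (n : nat).
Implicit Types (B D : 'M[R]_n.+1) (x eps : n.+1.-tuple R).

Definition supported (e : rel 'I_n.+1) B := forall i j, B i j != 0 -> e i j.

(* The solution of [X = B^T X + eps], see [semP]. *)
Definition sem B eps : n.+1.-tuple R :=
  [tuple (invmx (1%:M - B^T) *m cvec eps) i 0 | i < n.+1].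

Definition nominal B Bstar (a : {set 'I_n.+1}) : 'M[R]_n.+1 :=
  \matrix_(i, j) (if j \in a then Bstar i j else B i j).

Lemma semP e B eps x : topological e -> supported e B ->
  x = sem B eps <-> cvec x = B^T *m cvec x + cvec eps.
Proof.
move=> te sB.
have B0 (i j : 'I_n.+1) : (j <= i)%N -> B i j = 0.
  by move=> ji; apply/eqP/negPn/negP => /sB/te; rewrite ltnNge ji.
have unit1B : 1%:M - B^T \in unitmx.
  rewrite unitmxE det_trig; last first.
    apply/is_trig_mxP => i j ij; rewrite !mxE B0 ?(ltnW ij)// subr0.
    by rewrite -val_eqE/= (ltn_eqF ij).
  rewrite big1 ?unitr1// => i _; rewrite !mxE eqxx B0// subr0 //.
have semE : cvec (sem B eps) = invmx (1%:M - B^T) *m cvec eps.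
  by apply/colP => i; rewrite mxE tnth_mktuple.
split=> [->|xE].
  apply/eqP; rewrite -subr_eq0 opprD addrA -{1}[cvec (sem _ _)]mul1mx.
  by rewrite -mulmxBl semE mulmxA mulmxV// mul1mx subrr.
apply/eq_from_tnth => i; rewrite tnth_mktuple.
suff -> : cvec eps = (1%:M - B^T) *m cvec x by rewrite mulKmx// mxE.
by rewrite mulmxBl mul1mx {1}xE addrC addKr.
Qed.

End Linear_SEM.

Section Noise.
Variables (R : realType) (n : nat).
Local Open Scope ereal_scope.
Implicit Type P : probability (n.-tuple R) R.

Definition has_mean P (nu : n.-tuple R) :=
  forall i, 'E_P[fun x : n.-tuple R => tnth x i] = (tnth nu i)%:E.

Definition one_subgaussian P (nu : n.-tuple R) :=
  forall u : 'cV[R]_n,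
    'E_P[fun x : n.-tuple R =>
           expR (\sum_i u i 0 * (tnth x i - tnth nu i))%R]
    <= (expR (norm2 u ^+ 2 / 2))%:E.

Definition independent_coordinates P :=
  forall A : 'I_n -> set R, (forall i, measurable (A i)) ->
    P [set x | forall i, A i (tnth x i)] =
    \prod_(i < n) P [set x | A i (tnth x i)].

End Noise.

Section Product_law.
Context d (V : measurableType d) (R : realType).

Definition cons_pair m (x : V * m.-tuple V) : m.+1.-tuple V :=
  [the m.+1.-tuple V of x.1 :: x.2].

Lemma measurable_cons_pair m :
  measurable_fun [set: V * m.-tuple V] (@cons_pair m).
Proof. exact: measurable_cons. Qed.

HB.instance Definition _ m :=
  isMeasurableFun.Build _ _ _ _ (@cons_pair m) (@measurable_cons_pair m).

(* Law of [m] independent draws from [P]. *)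
Fixpoint iid (P : probability V R) m : probability (m.-tuple V) R :=
  if m is k.+1 then distribution (P \x iid P k)%E (@cons_pair k)
  else dirac [tuple].

End Product_law.

Section Bandit.
Variable R : realType.

(* The two kinds of deviation budget: in [frequency mc] the norm of each
   deviation is at most [mc] and deviating rounds are counted; in
   [aggregate] the norms are summed. *)
Inductive budget_kind := frequency of R | aggregate.

(* What the learner knows beforehand. *)
Record setting := Setting {
  nn : nat;
  edge : rel 'I_nn.+1;
  noise_mean : nn.+1.-tuple R;
  noise_bound : R;
  state_bound : R;
  horizon : nat;
  kind : budget_kind;
  budget : R }.

Definition action (S : setting) := {set 'I_(nn S).+1}.
Definition state (S : setting) := (nn S).+1.-tuple R.

(* What the learner does not know. [dev t a] is the actual weight matrix at
   round [t] (counted from 0) if the intervention [a] is selected. *)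
Record environment (S : setting) := Environment {
  weight : 'M[R]_((nn S).+1);
  weight_star : 'M[R]_((nn S).+1);
  noise : probability (state S) R;
  dev : nat -> action S -> 'M[R]_((nn S).+1) }.

(* A randomized learner: [act u h] is the intervention selected after the
   history [h] (oldest round first), [u] being a seed drawn once, beforehand,
   independently of the environment. *)
Record policy (S : setting) := Policy {
  seed_display : measure_display;
  seed_type : measurableType seed_display;
  seed_law : probability seed_type R;
  act : seed_type -> seq (action S * state S) -> action S;
  act_measurable : forall t (s : t.-tuple (action S)) (a : action S),
      measurable [set ux : seed_type * t.-tuple (state S) |
                    act ux.1 (zip s ux.2) = a] }.

Definition algorithm := forall S : setting, policy S.

Section Environments.
Variables (S : setting) (I : environment S).

Definition nominal_weight (a : action S) :=
  nominal (weight I) (weight_star I) a.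

Definition deviation t (a : action S) := dev I t a - nominal_weight a.

Definition C_DF : nat :=
  \max_(i < (nn S).+1) \sum_(t < horizon S)
    \max_(a : action S) nat_of_bool (norm2 (col i (deviation t a)) != 0)%R.

Definition C_AD : R :=
  \big[Num.max/0]_(i < (nn S).+1) \sum_(t < horizon S)
    \big[Num.max/0]_(a : action S) norm2 (col i (deviation t a)).

Definition budget_spent :=
  match kind S with
  | frequency mc =>
      (forall t a i, (t < horizon S)%N ->
         norm2 (col i (deviation t a)) <= mc) /\
      budget S = mc * C_DF%:R
  | aggregate => budget S = C_AD
  end.

Record valid_environment : Prop := {
  edge_topological : topological (@edge S);
  (* Every edge carries a nonzero weight in the nominal model, so that the
     degree and length of the graph are those of the model; interventions and
     deviations may cancel weights but create no edge. *)
  weight_edge : forall i j, weight I i j != 0 <-> edge i j;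
  weight_star_edge : supported (@edge S) (weight_star I);
  dev_edge : forall t a, (t < horizon S)%N -> supported (@edge S) (dev I t a);
  nominal_norm : forall a i, norm2 (col i (nominal_weight a)) <= 1;
  noise_has_mean : has_mean (noise I) (noise_mean S);
  noise_subgaussian : one_subgaussian (noise I) (noise_mean S);
  noise_independent : independent_coordinates (noise I);
  noise_bounded : {ae noise I, forall x, norm2 (cvec x) <= noise_bound S};
  nominal_bounded : forall a,
    {ae noise I, forall x,
       norm2 (cvec (sem (nominal_weight a) x)) <= state_bound S};
  dev_bounded : forall t a, (t < horizon S)%N ->
    {ae noise I, forall x,
       norm2 (cvec (sem (dev I t a) x)) <= state_bound S};
  budget_is_spent : budget_spent }.

Local Open Scope ereal_scope.

Definition mu (a : action S) : \bar R :=
  'E_(noise I)[fun x => tnth (sem (nominal_weight a) x) ord_max].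

Variable pi : policy S.

(* A realization of the run consists of a seed and the noise vectors of all
   the rounds. *)
Definition run_space : Type :=
  (seed_type pi * (horizon S).-tuple (state S))%type.

Definition run_law :
    probability (seed_type pi * (horizon S).-tuple (state S))%type R :=
  seed_law pi \x iid (noise I) (horizon S).

(* The default value of [nth] is irrelevant: only [t < horizon S] is used. *)
Definition noise_at (t : nat) (w : run_space) : state S :=
  nth (noise_mean S) w.2 t.

Fixpoint history (t : nat) (w : run_space) : seq (action S * state S) :=
  if t is k.+1 then
    let h := history k w in
    let a := act w.1 h in
    rcons h (a, sem (dev I k a) (noise_at k w))
  else [::].

Definition action_at t w : action S := act w.1 (history t w).

Definition state_at t w : state S :=
  sem (dev I t (action_at t w)) (noise_at t w).

Definition expected_regret : \bar R :=
  (horizon S)%:R%:E * (\big[maxe/-oo]_(a : action S) mu a)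
  - \sum_(t < horizon S) 'E_run_law[fun w => tnth (state_at t w) ord_max].

End Environments.

(* The budgets that can be spent within [T] rounds at the rate [q]: a bound on
   the norm of each deviation for [frequency], on [C / T] for [aggregate].
   Fixing [q] makes it possible to have a bound on the states that does not
   depend on [T]. *)
Definition attainable (q : R) (T : nat) (k : budget_kind) (C : R) :=
  match k with
  | frequency mc =>
      0 <= mc <= q /\ exists2 l : nat, (l <= T)%N & C = mc * l%:R
  | aggregate => 0 <= C <= q * T%:R
  end.

End Bandit.

Arguments aggregate {R}.

(* Main.v *)
(** The graph has [L] layers of [d] nodes, all edges joining a layer to the next,
    and the reward node on top; with weights [1 / sqrt d] every layer multiplies
    the values by [sqrt d]. Budget: the deviations lower the column of the reward
    node, hence the reward by [sqrt d ^ L] per unit of budget up to a constant,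
    whatever the learner does. Statistics: at one node of the first layer the
    nominal and the interventional weights differ by an amount which shifts its
    mean by [1 / sqrt T], in a direction unknown to the learner. The noise of that
    node lives on a lattice of this mesh, with masses given by the square of a
    tent, so that the laws of the observations in the two cases are shifts of one
    another by one atom, of affinity [1 - O(1 / T)]. They cannot be told apart in
    [T] rounds, whence a constant fraction of wrong decisions. *)

Require Import Defs.
From HB Require Import structures.
From mathcomp Require Import all_boot all_order all_algebra.
From mathcomp Require Import all_classical all_reals all_analysis.
From mathcomp Require Import measurable_realfun.
From mathcomp Require Import ring lra zify.

Set Implicit Arguments.
Unset Strict Implicit.
Unset Printing Implicit Defensive.

Import Order.TTheory GRing.Theory Num.Theory.
Import numFieldNormedType.Exports.
Local Open Scope classical_set_scope.
Local Open Scope ring_scope.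

(** * Elementary bounds on the exponential *)

Section Exponential_bounds.
Context {R : realType}.
Implicit Type x : R.

(** Multiplied by [1 - x], the left side is at most [expR x * expR (- x) = 1], while the right side
    becomes [1 + x ^+ 2 * (1 - 2 * x)]. *)
Lemma expR_le_quad x : x <= 2^-1 -> expR x <= 1 + x + 2 * x ^+ 2.
Proof.
move=> x2; have x1 : 0 < 1 - x by lra.
rewrite -(ler_pM2r x1); apply: (@le_trans _ _ 1).
  by rewrite -[leRHS](expRxMexpNx_1 x) ler_wpM2l ?expR_ge0// expR_ge1Dx.
have : 0 <= x ^+ 2 * (1 - 2 * x) by rewrite mulr_ge0 ?sqr_ge0//; lra.
nra.
Qed.

(** Weaker than [cosh x <= expR (x ^+ 2 / 2)], but enough for noise bounded by [1 / 2]. For small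
    [x] the linear terms of the quadratic bound cancel; otherwise [|x| <= 2 * x ^+ 2]. *)
Lemma expR_sym_le x : expR x + expR (- x) <= 2 * expR (2 * x ^+ 2).
Proof.
have e1 := expR_ge1Dx (2 * x ^+ 2).
have [xs|xb] := leP `|x| 2^-1.
  move: xs; rewrite ler_norml => /andP[x1 x2].
  have := expR_le_quad x2.
  have := @expR_le_quad (- x) ltac:(by rewrite lerNl).
  rewrite sqrrN; lra.
have le_sq : `|x| <= 2 * x ^+ 2.
  by rewrite -[x ^+ 2]real_normK ?num_real//; nra.
have h1 : expR x <= expR (2 * x ^+ 2).
  by rewrite ler_expR (le_trans _ le_sq)// ler_norm.
have h2 : expR (- x) <= expR (2 * x ^+ 2).
  by rewrite ler_expR (le_trans _ le_sq)// -normrN ler_norm.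
lra.
Qed.

End Exponential_bounds.

(** * Discrete laws *)

Section Atomic_law.
Context d (V : measurableType d) (R : realType).
Variables (M : nat) (g : nat -> R) (e : nat -> V).
Hypothesis sum_g : \sum_(k < M) g k ^+ 2 = 1.
Local Open Scope ereal_scope.

(* Masses are written as squares, so that affinities are polynomial in [g]. *)
Definition atomic of (\sum_(k < M) g k ^+ 2 = 1)%R : set V -> \bar R :=
  msum (fun k => mscale (NngNum (sqr_ge0 (g k))) (dirac (e k))) M.

HB.instance Definition _ := Measure.on (atomic sum_g).

Lemma atomicE A : atomic sum_g A = (\sum_(k < M) g k ^+ 2 * \1_A (e k))%:E.
Proof. by rewrite /atomic /msum/= -sumEFin; apply: eq_bigr. Qed.

Let atomicT : atomic sum_g setT = 1.
Proof.
by rewrite atomicE -[in RHS]sum_g; congr EFin; apply: eq_bigr => k _;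
  rewrite indicT mulr1.
Qed.

HB.instance Definition _ :=
  Measure_isProbability.Build _ _ _ (atomic sum_g) atomicT.

Definition atomic_prob : probability V R := atomic sum_g.

Lemma ge0_integral_atomic (f : V -> \bar R) :
  measurable_fun [set: V] f -> (forall x, 0 <= f x) ->
  \int[atomic_prob]_x f x = \sum_(k < M) (g k ^+ 2)%:E * f (e k).
Proof.
move=> mf f0; rewrite [LHS]ge0_integral_measure_sum//; apply: eq_bigr => k _.
by rewrite ge0_integral_mscale// integral_dirac//= diracT mul1e.
Qed.

Lemma integrable_atomic (f : V -> R) :
  measurable_fun [set: V] f -> (atomic_prob).-integrable [set: V] (EFin \o f).
Proof.
move=> mf; apply/integrableP; split; first exact/measurable_EFinP.
rewrite ge0_integral_atomic//; last exact/measurable_EFinP/measurableT_comp.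
rewrite (eq_bigr (fun k : 'I_M => (g k ^+ 2 * `|f (e k)|)%:E))//.
by rewrite sumEFin ltry.
Qed.

Lemma expectation_atomic (f : V -> R) : measurable_fun [set: V] f ->
  'E_(atomic_prob)[f] = (\sum_(k < M) g k ^+ 2 * f (e k))%:E.
Proof.
move=> mf; rewrite unlock integralE.
rewrite !ge0_integral_atomic//; last 2 first.
- by apply/measurable_funeneg/measurable_EFinP.
- by apply/measurable_funepos/measurable_EFinP.
under eq_bigr do rewrite funeposE -EFin_max -EFinM.
under [X in _ - X]eq_bigr do rewrite funenegE -EFinN -EFin_max -EFinM.
rewrite !sumEFin -EFinB -sumrB; congr EFin; apply: eq_bigr => k _ /=.
rewrite -mulrBr; congr (_ * _)%R.
by have [f0|f0] := leP 0%R (f (e k)); rewrite /Num.max; 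
  case: ltP; case: ltP; lra.
Qed.

(** The complement of the finite set of atoms serves as the measurable null set, whence the
    hypothesis on singletons. *)
Lemma ae_atomic (Q : set V) : (forall k, measurable [set e k]) ->
  (forall k, (k < M)%N -> Q (e k)) -> {ae atomic_prob, forall x, Q x}.
Proof.
move=> me Qe; exists (~` \big[setU/set0]_(k < M) [set e k]); split.
- by apply: measurableC; apply: bigsetU_measurable.
- rewrite [LHS]atomicE big1// => k _; rewrite indicE memNset ?mulr0//= => H.
  apply: H; rewrite -(bigcup_mkord M (fun k => [set e k])).
  by exists k => //=; exact: ltn_ord.
- move=> x nQ; rewrite -(bigcup_mkord M (fun k => [set e k])) => -[k /= kM xk].
  by apply: nQ; rewrite /= xk; exact: Qe.
Qed.

End Atomic_law.

Lemma measurable_tuple_set1 (R : realType) n (x : n.-tuple R) :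
  measurable [set x].
Proof.
rewrite (_ : [set x] =
    \bigcap_(i in @setT 'I_n) [set y | tnth y i = tnth x i]).
  apply: fin_bigcap_measurable => // i _.
  rewrite -[X in measurable X]setTI.
  exact: (@measurable_tnth _ R n i measurableT _ (measurable_set1 (tnth x i))).
apply/seteqP; split => [y /= -> i//|y /= yx].
by apply: eq_from_tnth => i; exact: yx.
Qed.

(** * Two-point testing *)

Section Two_point.
Context d (V : measurableType d) (R : realType).
Variables (M : nat) (g : nat -> R) (e : nat -> V).
Hypothesis sum_g : \sum_(k < M.+1) g k ^+ 2 = 1.

Let P : probability V R := atomic_prob e sum_g.

(** Fubini with the first draw isolated; its law being atomic, the outer integral is a finite
    sum. *)
Lemma iid_atomic_cons m (E : set (m.+1.-tuple V)) : measurable E ->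
  fine (iid P m.+1 E) =
  \sum_(k < M.+1) g k ^+ 2 *
    fine (iid P m [set xs | E (cons_pair (e k, xs))]).
Proof.
move=> mE; pose F := (@cons_pair _ V m) @^-1` E.
have mF : measurable F by rewrite -[F]setTI; exact: measurable_cons_pair.
rewrite [iid P m.+1 E](_ : _ = \int[P]_x iid P m (xsection F x))%E//.
rewrite ge0_integral_atomic//; last exact: measurable_fun_xsection.
have finP k : iid P m (xsection F (e k)) \is a fin_num.
  by apply: fin_num_measure; exact: measurable_xsection.
rewrite -sum_fine; last by move=> k _; rewrite fin_numM.
apply: eq_bigr => k _; rewrite fineM//=; congr (_ * fine (iid _ _ _)).
by apply/seteqP; split => xs /=; rewrite /xsection/= inE.
Qed.

(** Models a learner with a frozen seed in two worlds: [h] is its history, to which [st0] and [st1]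
    add the outcome of one draw. By [st01], draws one atom apart lead to the same history in both
    worlds, the direction of the shift depending on [h]. *)
Variables (H : Type) (st0 st1 : H -> V -> H) (bad0 bad1 : set H).
Hypothesis bad01 : forall h, bad0 h \/ bad1 h.
Hypothesis st01 : forall h, (forall k, st0 h (e k.+1) = st1 h (e k)) \/
                            (forall k, st0 h (e k) = st1 h (e k.+1)).

(** Hellinger affinity between the law of masses [g k ^+ 2] and its shift by one atom. *)
Let rho := \sum_(k < M) g k * g k.+1.

(** [m] and [t] are separate because the run space holds the draws of all rounds, while the history
    before round [t] uses only the first [t]. *)
Definition run_set m (st : H -> V -> H) (bad : set H) h t :=
  [set xs : m.-tuple V | bad (foldl st h (take t xs))].

Let run_set_cons m st bad h t x : measurable (@run_set m.+1 st bad h t.+1) ->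
  measurable (@run_set m st bad (st h x) t).
Proof.
move=> mE.
have mF : measurable ((@cons_pair _ V m) @^-1` @run_set m.+1 st bad h t.+1).
  rewrite -[X in measurable X]setTI.
  exact: (measurable_cons_pair measurableT mE).
rewrite [X in measurable X](_ : _ =
  xsection ((@cons_pair _ V m) @^-1` @run_set m.+1 st bad h t.+1) x).
  exact: measurable_xsection mF.
by apply/seteqP; split => xs /=; rewrite /xsection/= inE.
Qed.

(* The right-hand side is the multiple of the Hellinger affinity, corrected by
   the total mass, that lies below [min (a ^ 2) (b ^ 2)] at [t = 0]. *)
Lemma two_point t m h (a b : R) : (t <= m)%N ->
  measurable (@run_set m st0 bad0 h t) ->
  measurable (@run_set m st1 bad1 h t) ->
  3 / 4 * rho ^+ t * (a * b) - (a ^+ 2 + b ^+ 2) / 8 <=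
  a ^+ 2 * fine (iid P m (@run_set m st0 bad0 h t)) +
  b ^+ 2 * fine (iid P m (@run_set m st1 bad1 h t)).
Proof.
elim: t m h a b => [|t IH] m h a b tm m0 m1.
  have p0 := fine_ge0 (measure_ge0 (iid P m) (run_set st0 bad0 h 0)).
  have p1 := fine_ge0 (measure_ge0 (iid P m) (run_set st1 bad1 h 0)).
  (* [a ^+ 2 + (a ^+ 2 + b ^+ 2) / 8 - 3 / 4 * (a * b)] equals [(3 * a - b) ^+ 2 / 8], so the left
     side is at most [a ^+ 2], and symmetrically at most [b ^+ 2]. *)
  have sq := sqr_ge0 (3 * a - b); have sq' := sqr_ge0 (3 * b - a).
  have a0 := mulr_ge0 (sqr_ge0 a) p0; have b0 := mulr_ge0 (sqr_ge0 b) p1.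
  have [hb|hb] := bad01 h.
  - have : iid P m (run_set st0 bad0 h 0) = 1%E.
      rewrite -(probability_setT (iid P m)); congr (iid P m _).
      by apply/seteqP; split => // xs _; rewrite /run_set/= take0.
    rewrite expr0; move=> -> /=; nra.
  - have : iid P m (run_set st1 bad1 h 0) = 1%E.
      rewrite -(probability_setT (iid P m)); congr (iid P m _).
      by apply/seteqP; split => // xs _; rewrite /run_set/= take0.
    rewrite expr0; move=> -> /=; nra.
case: m tm m0 m1 => [//|m] tm m0 m1; rewrite !iid_atomic_cons//.
pose U k := fine (iid P m (run_set st0 bad0 (st0 h (e k)) t)).
pose W k := fine (iid P m (run_set st1 bad1 (st1 h (e k)) t)).
rewrite -[leRHS]/(a ^+ 2 * (\sum_(k < M.+1) g k ^+ 2 * U k) +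
                   b ^+ 2 * (\sum_(k < M.+1) g k ^+ 2 * W k)).
have U0 k : 0 <= g k ^+ 2 * U k by rewrite mulr_ge0 ?sqr_ge0 ?fine_ge0.
have W0 k : 0 <= g k ^+ 2 * W k by rewrite mulr_ge0 ?sqr_ge0 ?fine_ge0.
have sl : \sum_(k < M) g k ^+ 2 <= 1.
  by rewrite -[leRHS]sum_g big_ord_recr/= lerDl sqr_ge0.
have sr : \sum_(k < M) g k.+1 ^+ 2 <= 1.
  by rewrite -[leRHS]sum_g big_ord_recl/= lerDr sqr_ge0.
(* When atom [i] in the first world and atom [j] in the second give the same history, the remaining
   rounds pose the same problem with [a * g i] and [b * g j] in place of [a] and [b]. *)
have IHk i j : st0 h (e i) = st1 h (e j) -> 
    3 / 4 * rho ^+ t * (a * b) * (g i * g j) - 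
      (a ^+ 2 * g i ^+ 2 + b ^+ 2 * g j ^+ 2) / 8 <=
    a ^+ 2 * (g i ^+ 2 * U i) + b ^+ 2 * (g j ^+ 2 * W j).
  move=> ij; have mU := run_set_cons (e i) m0.
  have mW := run_set_cons (e j) m1; rewrite -ij in mW.
  have := IH m _ (a * g i) (b * g j) tm mU mW.
  by rewrite /U /W -ij !exprMn; lra.
(* The matched pairs of atoms produce one more factor [rho]. In each world one end atom stays
   unmatched; its term is nonnegative and is dropped. *)
have [sth|sth] := st01 h.
- rewrite [\sum_(k < _) _ * U k]big_ord_recl.
  rewrite [\sum_(k < _) _ * W k]big_ord_recr/=.
  apply: (@le_trans _ _ (\sum_(k < M) (a ^+ 2 * (g k.+1 ^+ 2 * U k.+1) +
                                       b ^+ 2 * (g k ^+ 2 * W k)))); last first.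
    rewrite big_split/= -!mulr_sumr !mulrDr; apply: lerD.
      by rewrite lerDr mulr_ge0// sqr_ge0.
    by rewrite lerDl mulr_ge0// sqr_ge0.
  apply: le_trans; last by apply: ler_sum => k _; apply: IHk; apply: sth.
  rewrite sumrB -mulr_sumr -mulr_suml big_split/= -!mulr_sumr exprSr.
  rewrite (eq_bigr (fun k : 'I_M => g k * g k.+1)) => [|k _]; last first.
    by rewrite mulrC.
  rewrite -/rho. have := sqr_ge0 a; have := sqr_ge0 b; nra.
- rewrite [\sum_(k < _) _ * U k]big_ord_recr.
  rewrite [\sum_(k < _) _ * W k]big_ord_recl/=.
  apply: (@le_trans _ _ (\sum_(k < M) (a ^+ 2 * (g k ^+ 2 * U k) +
                                 b ^+ 2 * (g k.+1 ^+ 2 * W k.+1)))); last first.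
    rewrite big_split/= -!mulr_sumr !mulrDr; apply: lerD.
      by rewrite lerDl mulr_ge0// sqr_ge0.
    by rewrite lerDr mulr_ge0// sqr_ge0.
  apply: le_trans; last by apply: ler_sum => k _; apply: IHk; apply: sth.
  rewrite sumrB -mulr_sumr -mulr_suml big_split/= -!mulr_sumr exprSr.
  rewrite -/rho. have := sqr_ge0 a; have := sqr_ge0 b; nra.
Qed.

End Two_point.

(** * Runs of a policy *)

Lemma iid_nth d (V : measurableType d) (R : realType) (P : probability V R)
    m t (x0 : V) (A : set V) : (t < m)%N -> measurable A ->
  iid P m [set xs | A (nth x0 xs t)] = P A.
Proof.
move=> + mA; elim: m t => [//|m IH] [|t] tm.
  rewrite [LHS](_ : _ = (P \x iid P m)%E (A `*` setT)).
    rewrite product_measure1E//. rewrite -[RHS]mule1.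
    by congr (_ * _)%E; exact: (probability_setT (iid P m)).
  by congr (P \x _)%E; apply/seteqP; split => x //= [].
rewrite [LHS](_ : _ =
    (P \x iid P m)%E (setT `*` [set xs : m.-tuple V | A (nth x0 xs t)])).
  rewrite product_measure1E//.
    rewrite -(IH _ tm) -[RHS]mul1e.
    by congr (_ * _)%E; exact: (probability_setT P).
  have -> : [set xs : m.-tuple V | A (nth x0 xs t)] =
            (fun xs : m.-tuple V => tnth xs (Ordinal (tm : t < m)%N)) @^-1` A.
    by apply/seteqP; split => xs /=; rewrite (tnth_nth x0).
  by rewrite -[X in measurable X]setTI; exact: measurable_tnth.
by congr (P \x _)%E; apply/seteqP; split => x //= [].
Qed.

Lemma measurable_sem (R : realType) n (B : 'M[R]_n.+1) :
  measurable_fun [set: n.+1.-tuple R] (sem B).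
Proof.
apply: (measurable_fun_tnthP _).2 => i.
rewrite (_ : _ \o _ = fun eps : n.+1.-tuple R =>
    \sum_j invmx (1%:M - B^T) i j * tnth eps j).
  apply: measurable_sum => j; apply: measurable_funM => //.
  exact: measurable_tnth.
apply/funext => eps /=; rewrite tnth_mktuple mxE.
by apply: eq_bigr => j _; rewrite mxE.
Qed.

Section Runs.
Variables (R : realType) (S : setting R) (I : environment S) (pi : policy S).
Local Notation T := (horizon S).
Local Notation wtype := (seed_type pi * T.-tuple (state S))%type.

(** The round number is read off as [size h], so that a single transition map, as in the two-point
    argument, drives the whole run. *)
Definition step (u : seed_type pi) (h : seq (action S * state S)) x :=
  rcons h (act u h, sem (dev I (size h) (act u h)) x).

Lemma size_history t (w : wtype) : size (history I t w) = t.
Proof. by elim: t => [//|t IH]; rewrite /= size_rcons IH. Qed.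

Lemma historyE t (w : wtype) :
  history I t w = mkseq (fun j => (action_at I j w, state_at I j w)) t.
Proof. by elim: t => [//|t IH]; rewrite mkseqS -IH. Qed.

Lemma history_foldl t (w : wtype) : (t <= T)%N ->
  history I t w = foldl (step w.1) [::] (take t w.2).
Proof.
elim: t => [|t IH] tT; first by rewrite take0.
rewrite (take_nth (noise_mean S)) ?size_tuple// foldl_rcons -IH ?(ltnW tT)//.
by rewrite /step size_history.
Qed.

Lemma measurable_noise_at t : (t < T)%N ->
  measurable_fun [set: wtype] (fun w : wtype => noise_at t w : state S).
Proof.
move=> tT; rewrite (_ : (fun w => _) =
    (fun xs : T.-tuple (state S) => tnth xs (Ordinal tT)) \o snd).
  by apply: measurableT_comp; [exact: measurable_tnth|exact: measurable_snd].
by apply/funext => w /=; rewrite (tnth_nth (noise_mean S)).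
Qed.

(** Strong induction on [t], splitting along the finitely many sequences [s] of past actions. Once
    [s] is fixed, the past states are the measurable functions [obs s] of the noise, and
    [act_measurable] applies. *)
Lemma measurable_action_at t a : (t < T)%N ->
  measurable [set w : wtype | action_at I t w = a].
Proof.
elim/ltn_ind: t a => t IH a tT.
pose obs (s : t.-tuple (action S)) (w : wtype) : t.-tuple (state S) :=
  [tuple sem (dev I j (tnth s j)) (noise_at j w) | j < t].
have mobs s : measurable_fun [set: wtype] (obs s).
  apply: (measurable_fun_tnthP _).2 => j.
  rewrite (_ : _ \o _ = sem (dev I j (tnth s j)) \o
     (fun w : wtype => noise_at j w : state S)).
    apply: measurableT_comp; first exact: measurable_sem.
    by apply: measurable_noise_at; exact: ltn_trans tT.
  by apply/funext => w /=; rewrite tnth_mktuple.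
rewrite (_ : [set _ | _] = \bigcup_(s in [set: t.-tuple (action S)])
  ((\bigcap_(j in [set: 'I_t]) [set w | action_at I j w = tnth s j]) `&`
   [set w : wtype | act w.1 (zip s (obs s w)) = a])).
  apply: fin_bigcup_measurable => [|s _]; first exact: finite_finset.
  apply: measurableI.
    apply: fin_bigcap_measurable => // j _.
    by apply: IH => //; exact: ltn_trans tT.
  have mpair : measurable_fun [set: wtype] (fun w => (w.1, obs s w)).
    by apply: measurable_fun_pair => //; exact: measurable_fst.
  rewrite -[X in measurable X]setTI.
  exact: (mpair measurableT _ (act_measurable s a)).
have histE (s : t.-tuple (action S)) w :
    (forall j : 'I_t, action_at I j w = tnth s j) ->
    history I t w = zip s (obs s w).
  move=> sE; rewrite historyE -[LHS]zip_unzip; congr zip.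
  - apply: (@eq_from_nth _ a); rewrite size_map size_mkseq ?size_tuple//.
    move=> j jt; rewrite (nth_map (a, noise_mean S)) ?size_mkseq//.
    by rewrite nth_mkseq//= (sE (Ordinal jt)) (tnth_nth a).
  - apply: (@eq_from_nth _ (noise_mean S)).
      by rewrite size_map size_mkseq size_tuple.
    rewrite size_map size_mkseq => j jt.
    rewrite (nth_map (a, noise_mean S)) ?size_mkseq//.
    rewrite nth_mkseq//= /state_at (sE (Ordinal jt)).
    transitivity (tnth (obs s w) (Ordinal jt)); first by rewrite tnth_mktuple.
    exact: tnth_nth.
apply/seteqP; split => w /=.
  move=> wa; pose s := [tuple action_at I j w | j < t].
  have sE j : action_at I (j : 'I_t) w = tnth s j by rewrite tnth_mktuple.
  exists s => //; split; first by move=> j _; exact: sE.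
  by move: wa; rewrite /action_at (histE s w sE).
move=> [s _ [/= ws wa]]; rewrite /action_at (histE s)// => j; exact: ws.
Qed.

Lemma run_law_noise_at t (A : set (state S)) : (t < T)%N -> measurable A ->
  run_law I pi [set w | A (noise_at t w)] = noise I A.
Proof.
move=> tT mA; have mnth : measurable
    [set xs : T.-tuple (state S) | A (nth (noise_mean S) xs t)].
  have -> : [set xs : T.-tuple (state S) | A (nth (noise_mean S) xs t)] =
      (fun xs : T.-tuple (state S) => tnth xs (Ordinal tT)) @^-1` A.
    by apply/seteqP; split => xs /=; rewrite (tnth_nth (noise_mean S)).
  by rewrite -[X in measurable X]setTI; exact: measurable_tnth.
rewrite -(iid_nth (noise I) (noise_mean S) tT mA).
rewrite [LHS](_ : _ = (seed_law pi \x iid (noise I) T)%E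
  (setT `*` [set xs : T.-tuple (state S) | A (nth (noise_mean S) xs t)])).
  rewrite product_measure1E// -[RHS]mul1e.
  by congr (_ * _)%E; exact: (probability_setT (seed_law pi)).
by congr (_ \x _)%E; apply/seteqP; split => x //= [].
Qed.

Lemma measurable_action_set t (bad : set (action S)) : (t < T)%N ->
  measurable [set w : wtype | bad (action_at I t w)].
Proof.
move=> tT; rewrite (_ : [set _ | _] =
    \bigcup_(a in bad) [set w | action_at I t w = a]).
  apply: fin_bigcup_measurable => [|a _]; last exact: measurable_action_at.
  exact: finite_finset.
by apply/seteqP; split => [w wb|w [a ba /= wa]]/=; 
  [exists (action_at I t w)|rewrite wa].
Qed.

Lemma measurable_state_at t i : (t < T)%N ->
  measurable_fun [set: wtype] (fun w : wtype => tnth (state_at I t w) i).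
Proof.
move=> tT; rewrite (_ : (fun w => _) = fun w : wtype =>
    \sum_(a : action S) \1_[set w | action_at I t w = a] w *
      tnth (sem (dev I t a) (noise_at t w)) i).
  apply: measurable_sum => a; apply: measurable_funM.
    by apply: measurable_indic; exact: measurable_action_at.
  apply: (measurableT_comp (measurable_tnth i)).
  by apply: (measurableT_comp (measurable_sem _)); exact: measurable_noise_at.
apply/funext => w; rewrite (bigD1 (action_at I t w))//= indicE mem_set// mul1r.
rewrite big1 ?addr0// => a aw; rewrite indicE memNset ?mul0r//=.
by move/esym/eqP; exact/negP.
Qed.

(** Bridge to the two-point argument: with the seed frozen, the event on the actual run is an event
    on a fold over the noise. *)
Lemma run_setE t (bad : set (action S)) u : (t < T)%N ->
  run_set (m := T) (step u) [set h | bad (act u h)] [::] t =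
  xsection [set w : wtype | bad (action_at I t w)] u.
Proof.
by move=> tT; apply/seteqP; split => xs; rewrite /xsection/= inE/= /action_at
  history_foldl ?(ltnW tT).
Qed.

Lemma measurable_run_set t (bad : set (action S)) u : (t < T)%N ->
  measurable (run_set (m := T) (step u) [set h | bad (act u h)] [::] t).
Proof.
move=> tT; rewrite run_setE//.
by apply: measurable_xsection; exact: measurable_action_set.
Qed.

Lemma measurable_iid_run_set t (bad : set (action S)) : (t < T)%N ->
  measurable_fun [set: seed_type pi] (fun u => iid (noise I) T
    (run_set (m := T) (step u) [set h | bad (act u h)] [::] t)).
Proof.
move=> tT; under eq_fun do rewrite run_setE//.
by apply: measurable_fun_xsection; exact: measurable_action_set.
Qed.

(** The product measure is by definition the integral over the seed of the measures of the
    sections. *)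
Lemma run_law_run_set t (bad : set (action S)) : (t < T)%N ->
  run_law I pi [set w | bad (action_at I t w)] =
  (\int[seed_law pi]_u iid (noise I) T
     (run_set (m := T) (step u) [set h | bad (act u h)] [::] t))%E.
Proof. by move=> tT; under eq_integral do rewrite run_setE//. Qed.

End Runs.

(** * Expectations over a run with atomic noise *)

Section Run_expectation.
Variables (R : realType) (S : setting R) (I : environment S) (pi : policy S).
Variables (M : nat) (g : nat -> R) (e : nat -> state S).
Hypothesis sum_g : \sum_(k < M) g k ^+ 2 = 1.
Hypothesis noiseE : noise I = atomic_prob e sum_g.
Local Notation T := (horizon S).
Local Notation wtype := (seed_type pi * T.-tuple (state S))%type.

Variables (t : nat) (tT : (t < T)%N).
Let eps (w : wtype) : state S := noise_at t w.

Let meps : measurable_fun [set: wtype] eps := measurable_noise_at tT.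

Let eps_mixin := isMeasurableFun.Build _ _ _ _ eps meps.
Let eps_mfun : {mfun wtype >-> state S} := HB.pack eps eps_mixin.

Let distE A : measurable A ->
  noise I A = distribution (run_law I pi) eps_mfun A.
Proof. by move=> mA; rewrite -(run_law_noise_at I pi tT mA). Qed.

Lemma integrable_noise_at (f : state S -> R) :
  measurable_fun [set: state S] f ->
  (run_law I pi).-integrable [set: wtype] (EFin \o (f \o eps)).
Proof.
move=> mf; have mE : measurable_fun [set: state S] (EFin \o f).
  exact/measurable_EFinP.
have := integrable_atomic e sum_g mf; rewrite -noiseE.
move=> /integrableP[_ foo]; apply/integrableP; split.
  exact: (measurableT_comp mE meps).
apply: le_lt_trans foo.
rewrite (eq_measure_integral (distribution (run_law I pi) eps_mfun)); last first.
  by move=> A mA _; exact: distE.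
by rewrite ge0_integral_distribution//; exact/measurableT_comp.
Qed.

Lemma expectation_noise_at (f : state S -> R) :
  measurable_fun [set: state S] f ->
  (\int[run_law I pi]_w (f (eps w))%:E =
   (\sum_(k < M) g k ^+ 2 * f (e k))%:E)%E.
Proof.
move=> mf; rewrite -(expectation_atomic e sum_g mf) unlock -noiseE.
rewrite (eq_measure_integral (distribution (run_law I pi) eps_mfun)); last first.
  by move=> A mA _; exact: distE.
rewrite integral_distribution//; first exact/measurable_EFinP.
exact: integrable_noise_at.
Qed.

Lemma run_ae (Q : set (state S)) : (forall k, (k < M)%N -> Q (e k)) ->
  (forall k, measurable [set e k]) ->
  {ae run_law I pi, forall w, Q (eps w)}.
Proof.
move=> Qe me; have := ae_atomic sum_g me Qe; rewrite -noiseE.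
move=> [A [mA A0 QA]]; exists (eps @^-1` A); split.
- by rewrite -[X in measurable X]setTI; exact: meps.
- by rewrite -[RHS]A0 distE.
- by move=> w /= nQ; exact: QA.
Qed.

Variables (X : wtype -> R) (bad : set (action S)).
Variables (c1 c2 c3 : R) (f : state S -> R).
Hypothesis mX : measurable_fun [set: wtype] X.
Hypothesis mf : measurable_fun [set: state S] f.
Hypothesis f_centered : \sum_(k < M) g k ^+ 2 * f (e k) = 0.
Hypothesis me : forall k, measurable [set e k].
Let Bad := [set w : wtype | bad (action_at I t w)].
Hypothesis XE : forall (w : wtype) k, (k < M)%N -> eps w = e k ->
  X w = c1 - c2 * \1_Bad w + c3 * f (e k).

(** [X] is almost surely affine in the indicator of a bad decision and in a centered function of the
    current noise, with no product of the two, so linearity of the integral suffices. *)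
Lemma expectation_affine :
  ('E_(run_law I pi)[X] = (c1 - c2 * fine (run_law I pi Bad))%R%:E)%E.
Proof.
have mBad : measurable Bad by exact: measurable_action_set.
have iBad : (run_law I pi).-integrable [set: wtype] (EFin \o \1_Bad).
  by apply: integrable_indic => //; rewrite ltey_eq fin_num_measure.
have if_ := integrable_noise_at mf.
have ic : (run_law I pi).-integrable [set: wtype] (EFin \o cst c1).
  exact: finite_measure_integrable_cst.
rewrite unlock (ae_eq_integral (fun w : wtype =>
  (c1%:E + (- c2)%:E * (\1_Bad w)%:E + c3%:E * (f (eps w))%:E)%E))//.
- rewrite integralD//; last 2 first.
  + by apply: integrableD => //; exact: integrableZl.
  + exact: integrableZl.
  rewrite integralD//; last exact: integrableZl.
  rewrite !integralZl// (expectation_noise_at mf) f_centered mule0 adde0.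
  rewrite integral_indic// setIT integral_cst//.
  rewrite [X in (c1%:E * X)%E](probability_setT (run_law I pi)) mule1.
  rewrite -[X in (_ + _ * X)%E]/(run_law I pi Bad).
  have [p ->] : exists p, run_law I pi Bad = p%:E.
    by exists (fine (run_law I pi Bad)); rewrite fineK ?fin_num_measure.
  by rewrite /= -EFinM -EFinD mulNr.
- exact/measurable_EFinP.
- have /integrableP[mi _] := if_; have /integrableP[mB _] := iBad.
  by do ?[apply: emeasurable_funD => //]; apply: emeasurable_funM.
- have := @run_ae [set x | exists2 k, (k < M)%N & x = e k] _ me.
  move=> /(_ (fun k kM => ex_intro2 _ _ k kM erefl)).
  apply: filterS => w /= [k kM wk] _.
  by rewrite (XE kM wk) wk -!EFinM -!EFinD mulNr.
Qed.

End Run_expectation.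

(** * The two-point bound for a randomized policy *)

Section Two_environments.
Variables (R : realType) (S : setting R).
Variables (I0 I1 : environment S) (pi : policy S).
Variables (M : nat) (g : nat -> R) (e : nat -> state S).
Hypothesis sum_g : \sum_(k < M.+1) g k ^+ 2 = 1.
Hypotheses (noise0 : noise I0 = atomic_prob e sum_g)
           (noise1 : noise I1 = atomic_prob e sum_g).
Variables bad0 bad1 : set (action S).
Hypothesis bad01 : forall a, bad0 a \/ bad1 a.
Hypothesis dev01 : forall t a,
  (forall k, sem (dev I0 t a) (e k.+1) = sem (dev I1 t a) (e k)) \/
  (forall k, sem (dev I0 t a) (e k) = sem (dev I1 t a) (e k.+1)).
Let rho := \sum_(k < M) g k * g k.+1.

(** For each seed the policy is deterministic and [two_point] applies with [a = b = 1]; the bound is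
    then integrated over the seed. *)
Lemma two_environments t : (t < horizon S)%N ->
  3 / 4 * rho ^+ t - 1 / 4 <=
  fine (run_law I0 pi [set w | bad0 (action_at I0 t w)]) +
  fine (run_law I1 pi [set w | bad1 (action_at I1 t w)]).
Proof.
move=> tT; set c := (X in X <= _).
have finb J (bad : set (action S)) :
    run_law J pi [set w | bad (action_at J t w)] \is a fin_num.
  by apply: fin_num_measure; exact: measurable_action_set.
(* Comparing integrals through [ge0_le_integral] requires a nonnegative lower bound; the other case
   is trivial. *)
have [c0|c0] := leP c 0; first by rewrite (le_trans c0)// addr_ge0 ?fine_ge0.
rewrite -fineD ?finb// -lee_fin fineK; last by rewrite fin_numD !finb.
rewrite !run_law_run_set// -ge0_integralD//; last 2 first.
- exact: measurable_iid_run_set.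
- exact: measurable_iid_run_set.
apply: (@le_trans _ _ (\int[seed_law pi]_u c%:E)%E).
  rewrite integral_cst// [X in (_ * X)%E](probability_setT (seed_law pi)).
  by rewrite mule1.
apply: ge0_le_integral => //.
- by move=> u _; rewrite lee_fin ltW.
- by apply: emeasurable_funD; exact: measurable_iid_run_set.
move=> u _; rewrite noise0 noise1.
have st01 h :
    (forall k, step I0 u h (e k.+1) = step I1 u h (e k)) \/
    (forall k, step I0 u h (e k) = step I1 u h (e k.+1)).
  by have [E|E] := dev01 (size h) (act u h); [left|right] => k; rewrite /step E.
have := two_point (bad0 := [set h | bad0 (act u h)])
  (bad1 := [set h | bad1 (act u h)]) sum_g (fun h => bad01 (act u h)) st01 1 1
  (ltnW tT) (measurable_run_set _ _ _ tT) (measurable_run_set _ _ _ tT).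
rewrite expr1n !mul1r mulr1 => H.
rewrite -[leRHS]fineK; last first.
  by rewrite fin_numD !fin_num_measure//; exact: measurable_run_set.
rewrite lee_fin fineD ?fin_num_measure//; try exact: measurable_run_set.
by apply: le_trans H; rewrite /c; lra.

Qed.

End Two_environments.

(** * Tent-shaped masses *)

Section Tent.
Variable R : realType.

Lemma bernoulli_ineq (x : R) t : x <= 1 -> 1 - t%:R * x <= (1 - x) ^+ t.
Proof.
move=> x1; elim: t => [|t IH]; first by rewrite mul0r subr0.
rewrite exprSr; apply: (@le_trans _ _ ((1 - t%:R * x) * (1 - x))).
  have : 0 <= t%:R * x ^+ 2 by rewrite mulr_ge0 ?sqr_ge0.
  by rewrite -natr1; nra.
by rewrite ler_wpM2r// subr_ge0.
Qed.

Lemma sum_sqr_ge K : K%:R ^+ 3 / 3 <= \sum_(k < K) (k.+1%:R : R) ^+ 2.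
Proof.
elim: K => [|K IH]; first by rewrite big_ord0 expr0n mul0r.
rewrite big_ord_recr/=; apply: le_trans (lerD IH (lexx _)).
by rewrite -natr1; have : 0 <= K%:R :> R by []; nra.
Qed.

Variable K : nat.
Local Notation M := K.*2.+1.

(** On its [2 * K + 2] points the tent takes the values [1, ..., K + 1, K + 1, ..., 1]. *)
Definition tent k : R := (minn k.+1 (M.+1 - k))%:R.

Let mass := \sum_(k < M.+1) tent k ^+ 2.

Lemma tent_sym k : (k < M.+1)%N -> tent (M - k) = tent k.
Proof.
by rewrite /tent => kM; congr _%:R; rewrite /minn; do 2 case: ifP; lia.
Qed.

Lemma tent_mass : 2 / 3 * K.+1%:R ^+ 3 <= mass.
Proof.
have eM : (M.+1 = K.+1 + K.+1)%N by rewrite -addnn; lia.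
rewrite /mass eM big_split_ord/= [X in _ + X](reindex_inj rev_ord_inj)/=.
rewrite [X in _ <= X + _](eq_bigr (fun k : 'I_K.+1 => k.+1%:R ^+ 2)); last first.
  move=> k _; have := ltn_ord k; rewrite /tent => kK; congr (_%:R ^+ 2).
  by rewrite /minn; case: ifP; lia.
rewrite [X in _ <= _ + X](eq_bigr (fun k : 'I_K.+1 => k.+1%:R ^+ 2)); last first.
  move=> k _; have := ltn_ord k; rewrite /tent => kK; congr (_%:R ^+ 2).
  by rewrite /minn; case: ifP; lia.
have := sum_sqr_ge K.+1; lra.
Qed.

(** Neighbouring values satisfy [2 * x * y = x ^+ 2 + y ^+ 2 - (x - y) ^+ 2 >= x ^+ 2 + y ^+ 2 - 1].
    Each of the two sums of squares misses one end value 1, which adds 2 to the [2 * K + 1] unit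
    losses. *)
Lemma tent_affinity :
  mass - (K.*2.+3)%:R / 2 <= \sum_(k < M) tent k * tent k.+1.
Proof.
have e1 : \sum_(k < M) tent k ^+ 2 = mass - 1.
  rewrite /mass [in RHS]big_ord_recr/= [tent M](_ : _ = 1) ?expr1n ?addrK//.
  by rewrite /tent (_ : minn _ _ = 1%N)//; lia.
have e2 : \sum_(k < M) tent k.+1 ^+ 2 = mass - 1.
  rewrite /mass [in RHS]big_ord_recl/= [tent 0](_ : _ = 1).
    by rewrite expr1n addrAC subrr add0r.
  by rewrite /tent (_ : minn _ _ = 1%N)//; lia.
have : \sum_(k < M) (tent k ^+ 2 + tent k.+1 ^+ 2 - 1) <=
       \sum_(k < M) 2 * (tent k * tent k.+1).
  apply: ler_sum => k _.
  have : (tent k - tent k.+1) ^+ 2 <= 1.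
    rewrite -real_normK ?num_real// expr_le1// ler_norml /tent.
    have := ltn_ord k; set a := minn _ _; set b := minn _ _ => kM.
    have : a%:R <= b.+1%:R :> R by rewrite ler_nat; lia.
    have : b%:R <= a.+1%:R :> R by rewrite ler_nat; lia.
    by rewrite -!natr1; lra.
  nra.
rewrite sumrB big_split/= e1 e2 sumr_const card_ord -mulr_sumr.
rewrite (_ : K.*2.+3%:R = K.*2.+1%:R + 2 :> R); last first.
  by rewrite -natrD; congr _%:R; lia.
lra.
Qed.

End Tent.

(* The tent has squared mass of order [K ^ 3], and neighbouring values differ by
   1, so that one step costs a fraction [1 / K ^ 2] of the affinity. *)
Lemma affinity_pmf (R : realType) (T : nat) : (0 < T)%N ->
  exists (K : nat) (g : nat -> R),
   [/\ K.+1%:R <= 6 * @Num.sqrt R T%:R,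
       \sum_(k < K.*2.+2) g k ^+ 2 = 1,
       forall k, (k < K.*2.+2)%N -> g (K.*2.+1 - k)%N = g k &
       forall t, (t <= T)%N ->
         3 / 4 <= (\sum_(k < K.*2.+1) g k * g k.+1) ^+ t].
Proof.
move=> T0; have sT1 : 1 <= Num.sqrt T%:R :> R.
  by rewrite -[leLHS]sqrtr1 ler_sqrt// ler1n.
have sT0 : 0 <= Num.sqrt T%:R :> R by exact: sqrtr_ge0.
have sqT : Num.sqrt T%:R ^+ 2 = T%:R :> R by rewrite sqr_sqrtr.
pose n := Num.truncn (Num.sqrt T%:R : R).
have /andP[n1 n2] := truncn_itv sT0; rewrite -/n in n1 n2.
(* Then [K + 1 = 3 * (n + 1)] lies between [3 * sqrt T] and [6 * sqrt T], as [n <= sqrt T < n + 1]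
   and [1 <= sqrt T]. *)
pose K := (3 * n + 2)%N.
have KE : K.+1%:R = 3 * (n%:R + 1) :> R.
  by rewrite natr1 -natrM; congr _%:R; rewrite /K; lia.
have K6 : K.+1%:R <= 6 * Num.sqrt T%:R :> R by rewrite KE; lra.
have K3 : 3 * Num.sqrt T%:R <= K.+1%:R :> R.
  by rewrite KE; move: n2; rewrite -natr1; lra.
pose mass : R := \sum_(k < K.*2.+2) tent R K k ^+ 2.
have massK : 2 / 3 * K.+1%:R ^+ 3 <= mass := tent_mass R K.
have K1 : 3 <= K.+1%:R :> R by lra.
have mass0 : 0 < mass.
  by apply: lt_le_trans massK; rewrite mulr_gt0 ?exprn_gt0//; lra.
exists K, (fun k => tent R K k / Num.sqrt mass); split => //.
- under eq_bigr do rewrite exprMn exprVn sqr_sqrtr ?(ltW mass0)//.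
  by rewrite -mulr_suml divff// gt_eqF.
- by move=> k kM; rewrite tent_sym.
move=> t tT; set rho := (X in X ^+ t).
(* A loss of at most [x] per step leaves [1 - T * x = 3 / 4] after [T] steps, by Bernoulli's
   inequality. *)
pose x : R := (4 * T%:R)^-1.
have TR : 1 <= T%:R :> R by rewrite ler1n.
have x1 : x <= 1 by rewrite /x invf_le1; lra.
have rhox : 1 - x <= rho.
  have -> : rho = (\sum_(k < K.*2.+1) tent R K k * tent R K k.+1) / mass.
    rewrite /rho mulr_suml; apply: eq_bigr => k _.
    by rewrite mulrACA -invfM -expr2 sqr_sqrtr ?(ltW mass0).
  rewrite ler_pdivlMr// (le_trans _ (tent_affinity R K))// -/mass mulrBl mul1r.
  rewrite lerD2l lerN2 /x ler_pdivlMl ?mulr_gt0 ?ltr0n//.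
  apply: le_trans massK; have -> : K.*2.+3%:R = 2 * K.+1%:R + 1 :> R.
    by rewrite -natrM natr1; congr _%:R; lia.
  set k : R := K.+1%:R in K1 K3 *.
  have kT : 9 * T%:R <= k ^+ 2.
    have : (3 * Num.sqrt T%:R) ^+ 2 <= k ^+ 2 by rewrite lerXn2r ?nnegrE; lra.
    by rewrite exprMn sqT; lra.
  have : (9 * T%:R) * (2 * k + 1) <= k ^+ 2 * (3 * k).
    by apply: ler_pM => //; lra.
  rewrite exprS; lra.
apply: (@le_trans _ _ ((1 - x) ^+ t)); last first.
  by rewrite lerXn2r ?nnegrE; lra.
apply: le_trans (bernoulli_ineq _ x1).
have : t%:R * x <= T%:R * x by rewrite ler_wpM2r ?ler_nat// /x invr_ge0; lra.
have -> : T%:R * x = 4^-1.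
  by rewrite /x invfM mulrCA divff ?mulr1// gt_eqF; lra.
lra.
Qed.

(** * The layered graph *)

Section Layered_graph.
Variables d L : nat.
Hypotheses (d0 : (0 < d)%N) (L0 : (0 < L)%N).
Local Notation n := (L * d)%N.

(** Node [i] lies in layer [i %/ d]. Layers [0] to [L - 1] are full, and the reward node [L * d] is
    alone in layer [L]. *)
Definition layered : rel 'I_n.+1 := fun i j => (i %/ d).+1 == (j %/ d)%N.

Lemma layer_le (j : 'I_n.+1) : (j %/ d <= L)%N.
Proof. by rewrite -[leqRHS](mulnK _ d0) leq_div2r// -ltnS ltn_ord. Qed.

(** Stated for any monoid law, as it serves both to count parents and to sum values over a layer. *)
Lemma big_layer T (idx : T) (op : Monoid.law idx) (F : nat -> T) l :
  (l < L)%N ->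
  \big[op/idx]_(i < n.+1 | (i %/ d)%N == l) F i =
  \big[op/idx]_(k < d) F (l * d + k)%N.
Proof.
move=> lL; have ln : (l * d + d <= n.+1)%N.
  by rewrite (leq_trans _ (leqnSn _))// -mulSnr leq_mul2r lL orbT.
rewrite -(big_mkord (fun i => (i %/ d)%N == l)).
rewrite (big_cat_nat (n := (l * d)%N))//=; last first.
  by rewrite (leq_trans _ ln)// leq_addr.
rewrite [X in op X _]big_nat_cond [X in op X _]big_pred0 ?Monoid.mul1m;
    last first.
  move=> i; apply/negP => /andP[/andP[_ il] /eqP ie]; move: il.
  by rewrite -ie ltnNge leq_trunc_div.
rewrite (big_cat_nat (n := (l * d + d)%N))/= ?leq_addr//.
rewrite [X in op _ X]big_nat_cond [X in op _ X]big_pred0 ?Monoid.mulm1;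
    last first.
  move=> i; apply/negP => /andP[/andP[il _] /eqP ie]; move: il.
  by rewrite -mulSnr leqNgt -ltn_divLR// ie ltnSn.
rewrite -{1}[(l * d)%N]add0n big_addn addKn big_mkord.
apply: congr_big => // [i|i _]; last by rewrite addnC.
by rewrite addnC divnMDl// divn_small ?addn0 ?eqxx.
Qed.

Lemma card_parents j : #|parents layered j| = if (d <= j)%N then d else 0%N.
Proof.
rewrite -sum1_card; case: leqP => dj.
  have jd : (0 < j %/ d)%N by rewrite divn_gt0.
  transitivity (\sum_(i < n.+1 | (i %/ d)%N == (j %/ d).-1) 1)%N.
    by apply: eq_bigl => i; rewrite inE /layered -(prednK jd) eqSS.
  rewrite (big_layer addn (fun=> 1%N)) ?sum1_card ?card_ord//.
  by rewrite prednK// layer_le.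
by rewrite big_pred0// => i; rewrite inE /layered [(j %/ d)%N]divn_small.
Qed.

Lemma topological_layered : topological layered.
Proof.
move=> i j /eqP ij; rewrite ltnNge; apply/negP => /(leq_div2r d).
by rewrite -ij ltnn.
Qed.

Lemma degree_layered : degree layered = d.
Proof.
apply/eqP; rewrite eqn_leq; apply/andP; split.
  by apply/bigmax_leqP => j _; rewrite card_parents; case: ifP.
apply: leq_trans (leq_bigmax (ord_max : 'I_n.+1)).
by rewrite card_parents/= leq_pmull.
Qed.

Lemma layered_path i p : path layered i p ->
  ((last i p %/ d)%N = i %/ d + size p)%N.
Proof.
elim: p i => [|j p IH] i /=; first by rewrite addn0.
by move=> /andP[/eqP ij /IH ->]; rewrite -ij addSnnS.
Qed.

Lemma has_length_layered : has_length layered L.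
Proof.
split; last first.
  move=> i p /layered_path pE; have := layer_le (last i p).
  by rewrite pE; apply: leq_trans; rewrite leq_addl.
(* A longest path goes through the first node of every layer. *)
pose f k : 'I_n.+1 := inord (k * d)%N.
have fE k : (k <= L)%N -> f k = (k * d)%N :> nat.
  by move=> kL; rewrite /f inordK// ltnS leq_mul2r kL orbT.
exists (f 0%N), (map f (iota 1 L)); split; last by rewrite size_map size_iota.
rewrite path_map; apply/(pathP 0%N) => k; rewrite size_iota => kL.
rewrite -[0%N :: iota 1 L]/(iota 0 L.+1) !nth_iota//; last exact: leqW.
by rewrite /layered/= !fE ?mulnK ?add0n ?(ltnW kL).
Qed.

End Layered_graph.

(** * The linear model on the layered graph *)

Section Layered_model.
Variables (R : realType) (d L : nat).
Hypotheses (d0 : (0 < d)%N) (L0 : (0 < L)%N).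
Local Notation n := (L * d)%N.
Local Notation rd := (Num.sqrt d%:R : R).

(** Signed norm of column [j] once the [d] equal weights are divided by [sqrt d]: [r] at the first
    node of layer 1, lowered by [kappa] at the reward node. For [L = 1] these nodes coincide and
    both changes apply. *)
Definition column_scale (r kappa : R) (j : nat) : R :=
  (if j == d then r else 1) - (if j == n then kappa else 0).

Definition weights (alpha kappa : R) : 'M[R]_n.+1 :=
  \matrix_(i, j) ((@layered d L i j)%:R * (column_scale alpha kappa j / rd)).

(** The sources receive the constant 1, which feeds the graph; only node [d] is random. *)
Definition noise_vec (eps : R) : n.+1.-tuple R :=
  [tuple (i < d)%N%:R + (i == d :> nat)%:R * eps | i < n.+1].

(** Closed form, justified by [sum_layer], of the total value of layer [l]. *)
Definition layer_sum (r : R) (l : nat) : R :=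
  rd ^+ l * (if l == 0%N then d%:R else d%:R - 1 + r).

Definition node_value (r kappa : R) (j : nat) : R :=
  if (j < d)%N then 1
  else column_scale r kappa j * (layer_sum r (j %/ d).-1 / rd).

Lemma rd_gt0 : 0 < rd. Proof. by rewrite sqrtr_gt0 ltr0n. Qed.

Lemma rd_ge1 : 1 <= rd.
Proof. by rewrite -[leLHS]sqrtr1 ler_sqrt ?ler1n ?ler0n. Qed.

Lemma sqr_rd : rd ^+ 2 = d%:R. Proof. by rewrite sqr_sqrtr. Qed.

Lemma div_rd : d%:R / rd = rd.
Proof. by rewrite -[X in X / _]sqr_rd expr2 mulfK ?gt_eqF ?rd_gt0. Qed.

(** [kappa] disappears from the sum because the only node it lowers is in layer [L]. *)
Lemma sum_layer r kappa l : (l < L)%N ->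
  \sum_(i < n.+1 | (i %/ d)%N == l) node_value r kappa i = layer_sum r l.
Proof.
move=> lL; have rd0 : rd != 0 by rewrite gt_eqF ?rd_gt0.
rewrite (big_layer d0 +%R (node_value r kappa))//.
case: l lL => [|l] lL.
  rewrite /layer_sum expr0 mul1r (eq_bigr (fun=> 1)).
    by rewrite sumr_const card_ord.
  by move=> k _; rewrite /node_value mul0n add0n ltn_ord.
pose c (k : nat) : R := if (l == 0%N) && (k == 0%N) then r else 1.
rewrite (eq_bigr (fun k : 'I_d => c k * (layer_sum r l / rd))); last first.
  move=> k _; have kd := ltn_ord k.
  rewrite /node_value ltnNge mulSn -addnA leq_addr/=.
  rewrite addnA -mulSn divnMDl// divn_small// addn0/=; congr (_ * _).
  rewrite /column_scale [X in _ - X](_ : _ = 0) ?subr0.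
    rewrite /c mulSn -addnA -[X in _ == X]addn0 eqn_add2l addn_eq0 muln_eq0.
    by rewrite (gtn_eqF d0) orbF.
  rewrite ltn_eqF//; apply: (@leq_trans (l.+2 * d)).
    by rewrite [leqRHS]mulSnr ltn_add2l.
  by rewrite leq_mul2r lL orbT.
rewrite -mulr_suml; have -> : \sum_(k < d) c k =
    if l == 0%N then d%:R - 1 + r else d%:R.
  rewrite /c; case: eqP => _ /=; last first.
    by rewrite sumr_const card_ord.
  case: (d) d0 => // d' _; rewrite big_ord_recl/= sumr_const card_ord.
  by rewrite -natr1; ring.
rewrite /layer_sum/= exprS; case: eqP => [->|_].
  by rewrite expr0 mul1r div_rd mulr1 mulrC.
by rewrite -[X in _ = X * _ * _]div_rd; field.
Qed.

Lemma weights_supported alpha kappa :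
  supported (@layered d L) (weights alpha kappa).
Proof.
by move=> i j; rewrite mxE; case: (layered i j) => //; rewrite mul0r eqxx.
Qed.

(** Node [d] has [d] parents of value 1, so its noise [eps] acts as an increase of [alpha] by
    [eps / rd]. This is what lets a shift of the noise compensate a change of weight. *)
Lemma sem_weights alpha kappa eps :
  sem (weights alpha kappa) (noise_vec eps) =
  [tuple node_value (alpha + eps / rd) kappa i | i < n.+1].
Proof.
apply/esym; apply: (@semP _ _ (@layered d L) _ _ _ _ _).2;
  [exact: topological_layered|exact: weights_supported|].
have rd0 : rd != 0 by rewrite gt_eqF ?rd_gt0.
set r := alpha + _.
apply/colP => j; rewrite !mxE !tnth_mktuple.
under eq_bigr do rewrite !mxE tnth_mktuple.
have [jd|dj] := ltnP j d.
  rewrite /node_value jd big1 ?add0r.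
    by rewrite (ltn_eqF jd) mul0r addr0.
  by move=> i _; rewrite /layered [(j %/ d)%N]divn_small// mul0r mul0r.
have jd : (0 < j %/ d)%N by rewrite divn_gt0.
rewrite (bigID (fun i : 'I_n.+1 => (i %/ d)%N == (j %/ d).-1))/=.
rewrite [X in _ + X + _]big1 ?addr0; last first.
  move=> i ij; rewrite /layered -(prednK jd) eqSS (negbTE ij).
  by rewrite mul0r mul0r.
rewrite (eq_bigr (fun i : 'I_n.+1 =>
    column_scale alpha kappa j / rd * node_value r kappa i)); last first.
  by move=> i /eqP ij; rewrite /layered ij (prednK jd) eqxx mul1r.
rewrite -mulr_sumr sum_layer; last by rewrite prednK// layer_le.
rewrite {1}/node_value ltnNge dj/= /column_scale.
have [jE|jE] := eqVneq (j : nat) d; last first.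
  by rewrite mul0r !addr0 [RHS]mulrAC mulrA.
rewrite jE divnn d0 /layer_sum/= expr0 !mul1r div_rd.
rewrite [X in _ = X + _]mulrAC -[X in _ = X + _]mulrA div_rd /r.
by field.
Qed.

Lemma column_scale0 r j : column_scale r 0 j = if j == d then r else 1.
Proof. by rewrite /column_scale if_same subr0. Qed.

Lemma norm2_layered_col (B : 'M[R]_n.+1) c j :
  (forall i, B i j = (@layered d L i j)%:R * (c / rd)) ->
  norm2 (col j B) = if (d <= j)%N then `|c| else 0.
Proof.
move=> BE; rewrite /norm2; under eq_bigr do rewrite mxE BE exprMn.
rewrite -mulr_suml.
have -> : \sum_i ((@layered d L i j)%:R : R) ^+ 2 =
          #|parents (@layered d L) j|%:R.
  rewrite -sum1_card natr_sum [RHS]big_mkcond/=; apply: eq_bigr => i _.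
  by rewrite inE; case: layered; rewrite ?expr1n ?expr0n.
rewrite card_parents//; case: ifP => _; last by rewrite mul0r sqrtr0.
rewrite exprMn exprVn sqr_rd mulrCA divff ?mulr1 ?sqrtr_sqr//.
by rewrite pnatr_eq0 -lt0n.
Qed.

(** Affine in [r]: this is what reduces expected rewards to error probabilities. For [L = 1] the
    node of scale [r] is the reward node itself. *)
Lemma reward_value r kappa :
  node_value r kappa n = if L == 1%N then rd * (r - kappa)
    else rd ^+ L.-2 * (1 - kappa) * (d%:R - 1 + r).
Proof.
have rd0 : rd != 0 by rewrite gt_eqF ?rd_gt0.
rewrite /node_value ltnNge leq_pmull//= /column_scale eqxx mulnK//.
have -> : (n == d) = (L == 1%N) by rewrite -[X in _ == X]mul1n eqn_pmul2r.
case: L L0 => [//|[|l]] _ /=.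
  by rewrite /layer_sum/= expr0 mul1r div_rd mulrC.
by rewrite /layer_sum/= exprS; field.
Qed.

(** A crude bound, but depending on [d], [L] and [q] only, so that the bound on the states can be
    fixed before the horizon. *)
Lemma node_value_bound r kappa q j : 0 <= kappa <= q -> `|r| <= 2 ->
  (j <= n)%N -> `|node_value r kappa j| <= (2 + q) * (rd ^+ L * (d%:R + 1)).
Proof.
move=> /andP[k0 kq] r2 jn; have q0 := le_trans k0 kq.
have rd1 := rd_ge1; have d1 : 1 <= d%:R :> R by rewrite ler1n.
have rdL : 1 <= rd ^+ L by rewrite exprn_ege1.
have big1' : 1 <= rd ^+ L * (d%:R + 1).
  by rewrite -[leLHS]mulr1 ler_pM//; lra.
rewrite /node_value; case: ifP => jd.
  by rewrite normr1 -[leLHS]mulr1 ler_pM//; lra.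
rewrite normrM ler_pM//.
  rewrite /column_scale (le_trans (ler_normB _ _))// lerD//.
    by case: ifP => _ //; rewrite normr1; lra.
  by case: ifP => _; rewrite ?normr0// ger0_norm.
rewrite normrM -[leRHS]mulr1 ler_pM//; last first.
  by rewrite normfV ger0_norm ?invf_le1 ?rd_gt0// ltW ?rd_gt0.
rewrite /layer_sum normrM ler_pM//.
  rewrite ger0_norm ?exprn_ge0 ?sqrtr_ge0// ler_weXn2l//.
  apply: leq_trans (leq_pred _) _.
  by rewrite -[leqRHS](mulnK _ d0) leq_div2r.
case: ifP => _; first by rewrite ger0_norm; lra.
by move: r2; rewrite !ler_norml => /andP[]; lra.
Qed.

End Layered_model.

(** * The hard environments *)

(** In the frequency case the norm [mc] is spent in each of the first [l] rounds; in the aggregate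
    case [C / T] is spent in every round. *)
Lemma attainable_schedule (R : realType) (q : R) T (kd : budget_kind R) C :
  (0 < T)%N -> attainable q T kd C -> exists kappa : nat -> R,
  [/\ forall t, 0 <= kappa t <= q, \sum_(t < T) kappa t = C &
      match kd with
      | frequency mc => (forall t, kappa t <= mc) /\
          C = mc * (\sum_(t < T) (kappa t != 0%R))%N%:R
      | aggregate => True
      end].
Proof.
move=> T0; case: kd => [mc /= [/andP[mc0 mcq] [l lT ->]]|/= /andP[C0 CT]].
  exists (fun t => if (t < l)%N then mc else 0).
  have E (V : nmodType) (x : V) :
      \sum_(t < T) (if (t < l)%N then x else 0) = x *+ l.
    rewrite -big_mkcond/= -(big_mkord (fun t => t < l)%N (fun=> x)).
    by rewrite -(big_nat_widen 0 l T predT (fun=> x) lT) sumr_const_nat subn0.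
  split.
  - by move=> t; case: ifP => _; rewrite ?mc0 ?lexx ?mcq ?(le_trans mc0).
  - by rewrite E mulr_natr.
  split; first by move=> t; case: ifP.
  (* If [mc = 0], the count of deviating rounds is 0 instead of [l], but both products vanish. *)
  have [->|m0] := eqVneq mc 0; first by rewrite !mul0r.
  congr (_ * _%:R); rewrite -[LHS]natn -(E nat 1%N); apply: eq_bigr => t _.
  by case: ifP; rewrite ?m0 ?eqxx.
exists (fun=> C / T%:R); have TR : 0 < T%:R :> R by rewrite ltr0n.
split => //.
  by move=> _; rewrite divr_ge0 ?ler0n//= ler_pdivrMr.
by rewrite sumr_const card_ord -[LHS]mulr_natr divfK// gt_eqF.
Qed.

Lemma norm2_le (R : realType) n (v : 'cV[R]_n) (m : R) :
  (forall i, `|v i 0| <= m) -> norm2 v <= Num.sqrt (n%:R * m ^+ 2).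
Proof.
move=> vm; rewrite ler_wsqrtr//.
rewrite mulr_natl -[X in _ *+ X](card_ord n) -sumr_const; apply: ler_sum => i _.
rewrite -[_ ^+ 2]real_normK ?num_real//.
by rewrite lerXn2r ?nnegrE// (le_trans _ (vm i)).
Qed.

Section Instance.
Variables (R : realType) (d L : nat) (q : R).
Variables (T : nat) (kd : budget_kind R) (C : R).
Hypotheses (d0 : (0 < d)%N) (L0 : (0 < L)%N).
Variables (K : nat) (g : nat -> R).
Hypothesis sum_g : \sum_(k < K.*2.+2) g k ^+ 2 = 1.
Hypothesis sym_g : forall k, (k < K.*2.+2)%N -> g (K.*2.+1 - k)%N = g k.
Variable kappa : nat -> R.
Hypothesis kappa_le : forall t, 0 <= kappa t <= q.
Hypothesis sum_kappa : \sum_(t < T) kappa t = C.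
Hypothesis kappa_budget : match kd with
      | frequency mc => (forall t, kappa t <= mc) /\
          C = mc * (\sum_(t < T) (kappa t != 0%R))%N%:R
      | aggregate => True
      end.

Local Notation n := (L * d)%N.
Local Notation rd := (Num.sqrt d%:R : R).

(** The atoms are odd multiples of [mesh], symmetric about 0 and within [1 / 2] of it. Neighbours
    are [2 * mesh] apart, which [half_gap] makes equivalent to a change of [2 * half_gap] in the
    weight. *)
Definition mesh : R := (4 * K.+1%:R)^-1.
Definition noise_atom (k : nat) : R := mesh * (2 * k%:R - K.*2.+1%:R).
Definition half_gap : R := mesh / rd.

Definition state_norm_bound : R :=
  Num.sqrt (n.+1%:R * ((2 + q) * (rd ^+ L * (d%:R + 1))) ^+ 2).

(** Common to both environments, so that the algorithm plays the same policy in both. *)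
Definition hard_setting : setting R :=
  @Setting R n (@layered d L) (noise_vec d L 0) (2 * rd) state_norm_bound
    T kd C.

Definition noise_tuple k : state hard_setting := noise_vec d L (noise_atom k).

(* The first node of layer 1; this is the reward node when [L = 1]. *)
Definition switch : 'I_n.+1 := inord d.

Definition switch_scale (b : bool) (a : action hard_setting) : R :=
  if (switch \in a) == b then 1 / 2 - half_gap else 1 / 2 + half_gap.

(* Intervening on [switch] loses [2 * half_gap] in [hard_env true] and gains it
   in [hard_env false]. *)
Definition hard_env (b : bool) : environment hard_setting :=
  @Environment R hard_setting
    (weights d L (1 / 2 + (-1) ^+ (~~ b) * half_gap) 0)
    (weights d L (1 / 2 - (-1) ^+ (~~ b) * half_gap) 0)
    (atomic_prob noise_tuple sum_g)
    (fun t a => weights d L (switch_scale b a) (kappa t)).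

Lemma switchE : switch = d :> nat.
Proof. by rewrite inordK// ltnS leq_pmull. Qed.

Lemma mesh_itv : 0 < mesh <= 1 / 4.
Proof.
have K1 : 1 <= K.+1%:R :> R by rewrite ler1n.
rewrite /mesh invr_gt0 mulr_gt0/= ?ltr0n// mul1r lef_pV2 ?posrE//.
by lra.
Qed.

Lemma half_gap_itv : 0 < half_gap <= 1 / 4.
Proof.
have /andP[m0 m1] := mesh_itv; have rd1 := rd_ge1 R d0.
rewrite /half_gap divr_gt0 ?rd_gt0//= ler_pdivrMr ?rd_gt0//; nra.
Qed.

Lemma switch_scale_itv b a : 1 / 4 <= switch_scale b a <= 3 / 4.
Proof.
by have /andP[? ?] := half_gap_itv; rewrite /switch_scale; case: ifP => _; lra.
Qed.

Lemma noise_atom_le k : (k < K.*2.+2)%N -> `|noise_atom k| <= 1 / 2.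
Proof.
move=> kK; have K1 : 1 <= K.+1%:R :> R by rewrite ler1n.
have KE : K.*2.+1%:R = 2 * K.+1%:R - 1 :> R.
  by rewrite -[1]/(1%:R) -natrM -natrB//; congr _%:R; lia.
have kK' : k%:R <= 2 * K.+1%:R - 1 :> R by rewrite -KE ler_nat.
have k0 : 0 <= k%:R :> R by [].
rewrite /noise_atom /mesh mulrC ler_norml ler_pdivlMr ?ler_pdivrMr; lra.
Qed.

Lemma noise_atom_sym k : (k < K.*2.+2)%N ->
  noise_atom (K.*2.+1 - k) = - noise_atom k.
Proof. by move=> kK; rewrite /noise_atom natrB//; ring. Qed.

Lemma sum_sym (F : R -> R) :
  \sum_(k < K.*2.+2) g k ^+ 2 * F (noise_atom k) =
  \sum_(k < K.*2.+2) g k ^+ 2 * F (- noise_atom k).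
Proof.
rewrite (reindex_inj rev_ord_inj)/=; apply: eq_bigr => k _.
by rewrite subSS sym_g// noise_atom_sym.
Qed.

Lemma noise_centered : \sum_(k < K.*2.+2) g k ^+ 2 * noise_atom k = 0.
Proof.
have := sum_sym id; rewrite /= => E; apply/eqP.
rewrite -[_ == _](mulrn_eq0 _ 2) mulr2n {1}E -big_split/=.
by apply/eqP; apply: big1 => k _; rewrite mulrN addNr.
Qed.

Lemma nominal_weightE b a :
  nominal_weight (hard_env b) a = weights d L (switch_scale b a) 0.
Proof.
apply/matrixP => i j; rewrite !mxE /column_scale /switch_scale.
have [jE|jd] := eqVneq (j : nat) d; last by case: ifP.
have -> : j = switch by apply: val_inj; rewrite /= jE switchE.
by case: (switch \in a); case: b => /=;
  rewrite ?expr0 ?expr1 ?mul1r ?mulN1r ?opprK.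
Qed.

Lemma sem_nominal b a k : sem (nominal_weight (hard_env b) a) (noise_tuple k) =
  [tuple node_value d L (switch_scale b a + noise_atom k / rd) 0 i | i < n.+1].
Proof. by rewrite nominal_weightE sem_weights. Qed.

Lemma sem_dev b t a k : sem (dev (hard_env b) t a) (noise_tuple k) =
  [tuple node_value d L (switch_scale b a + noise_atom k / rd) (kappa t) i
     | i < n.+1].
Proof. by rewrite sem_weights. Qed.

Lemma state_bounded b a k x : (k < K.*2.+2)%N -> 0 <= x <= q ->
  norm2 (cvec [tuple node_value d L (switch_scale b a + noise_atom k / rd) x i
     | i < n.+1]) <= state_norm_bound.
Proof.
move=> kK xq; apply: norm2_le => i; rewrite mxE tnth_mktuple.
apply: node_value_bound => //; last by rewrite -ltnS.
have := switch_scale_itv b a; have := noise_atom_le kK => n1 /andP[s1 s2].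
rewrite (le_trans (ler_normD _ _))// normrM normfV (ger0_norm (sqrtr_ge0 _)).
have : `|noise_atom k| / rd <= `|noise_atom k|.
  by rewrite ler_pdivrMr ?rd_gt0// ler_peMr ?rd_ge1.
by rewrite [`|switch_scale b a|]ger0_norm; lra.
Qed.

Lemma noise_tupleE k i :
  tnth (noise_tuple k) i = (i < d)%N%:R + (i == switch)%:R * noise_atom k.
Proof. by rewrite tnth_mktuple -val_eqE/= switchE. Qed.

Lemma noise_meanE i : tnth (noise_mean hard_setting) i = (i < d)%N%:R.
Proof. by rewrite tnth_mktuple mulr0 addr0. Qed.

Lemma noise_norm k : (k < K.*2.+2)%N -> norm2 (cvec (noise_tuple k)) <= 2 * rd.
Proof.
move=> kK; have d1 : 1 <= d%:R :> R by rewrite ler1n.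
have -> : 2 * rd = Num.sqrt (4 * d%:R).
  by rewrite sqrtrM// (_ : 4 = 2 ^+ 2) ?sqrtr_sqr ?ger0_norm//; lra.
rewrite ler_wsqrtr//.
have -> : \sum_i cvec (noise_tuple k) i 0 ^+ 2 =
    \sum_(i < n.+1) ((i < d)%N%:R + (i == switch)%:R * noise_atom k ^+ 2).
  apply: eq_bigr => i _; rewrite mxE noise_tupleE.
  have [->|_] := eqVneq i switch; rewrite ?switchE ?ltnn/=.
    by rewrite !add0r !mul1r.
  by rewrite !mul0r !addr0; case: (i < d)%N; rewrite ?expr1n ?expr0n.
rewrite big_split/= [X in _ + X](_ : _ = noise_atom k ^+ 2); last first.
  rewrite (bigD1 switch)//= eqxx mul1r big1 ?addr0// => i /negbTE ->.
  by rewrite mul0r.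
rewrite (eq_bigr (fun i : 'I_n.+1 => if (i %/ d == 0)%N then 1 else 0));
    last first.
  by move=> i _; rewrite eqn0Ngt divn_gt0// -ltnNge; case: ltnP.
rewrite -big_mkcond (big_layer d0 +%R (fun=> 1))// sumr_const card_ord.
have := noise_atom_le kK; rewrite ler_norml => /andP[n1 n2]; nra.
Qed.

Let mtnth i : measurable_fun [set: state hard_setting]
  (fun x : state hard_setting => tnth x i).
Proof. exact: measurable_tnth. Qed.

Lemma hard_env_mean b : has_mean (noise (hard_env b)) (noise_mean hard_setting).
Proof.
move=> i; rewrite expectation_atomic//; congr EFin.
under eq_bigr do rewrite noise_tupleE mulrDr mulrCA.
rewrite big_split/= -mulr_suml -mulr_sumr sum_g noise_centered.
by rewrite mulr0 addr0 mul1r noise_meanE.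
Qed.

(** Only the coordinate [switch] deviates from its mean. Symmetry of the law turns the exponential
    into a hyperbolic cosine, and [|noise_atom k| <= 1 / 2] brings the exponent of [expR_sym_le]
    down to [u switch 0 ^+ 2 / 2]. *)
Lemma hard_env_subgaussian b :
  one_subgaussian (noise (hard_env b)) (noise_mean hard_setting).
Proof.
move=> u; rewrite expectation_atomic; last first.
  apply: measurableT_comp => //; apply: measurable_sum => i.
  by apply: measurable_funM => //; apply: measurable_funB.
rewrite lee_fin.
have E k : \sum_i u i 0 *
      (tnth (noise_tuple k) i - tnth (noise_mean hard_setting) i) =
    u switch 0 * noise_atom k.
  rewrite (bigD1 switch)//= big1 ?addr0.
    by rewrite noise_tupleE noise_meanE eqxx addrAC subrr add0r mul1r.
  move=> i /negbTE iv; rewrite noise_tupleE noise_meanE iv mul0r addr0 subrr.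
  by rewrite mulr0.
under eq_bigr do rewrite E.
have usq : u switch 0 ^+ 2 <= norm2 u ^+ 2.
  rewrite sqr_sqrtr ?sumr_ge0//; last by move=> i _; exact: sqr_ge0.
  by rewrite (bigD1 switch)//= lerDl sumr_ge0// => i _; exact: sqr_ge0.
have S2 : 2 * \sum_(k < K.*2.+2) g k ^+ 2 * expR (u switch 0 * noise_atom k) =
    \sum_(k < K.*2.+2) g k ^+ 2 * (expR (u switch 0 * noise_atom k) +
                                   expR (- (u switch 0 * noise_atom k))).
  rewrite mulr_natl mulr2n {2}(sum_sym (fun x => expR (u switch 0 * x))).
  by rewrite -big_split/=; apply: eq_bigr => k _; rewrite mulrN mulrDr.
rewrite -(ler_pM2l (ltr0n R 2)) S2.
apply: (@le_trans _ _ (\sum_(k < K.*2.+2) g k ^+ 2 *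
                        (2 * expR (norm2 u ^+ 2 / 2)))).
  apply: ler_sum => k _; rewrite ler_wpM2l ?sqr_ge0//.
  apply: le_trans (expR_sym_le _) _; rewrite ler_pM2l// ler_expR exprMn.
  have : noise_atom k ^+ 2 <= 1 / 4.
    by have := noise_atom_le (ltn_ord k); rewrite ler_norml => /andP[]; nra.
  have := sqr_ge0 (noise_atom k); have := sqr_ge0 (u switch 0); nra.
by rewrite -mulr_suml sum_g mul1r.
Qed.

(** All coordinates but [switch] are constant. If these constants lie in their sets, both sides are
    the marginal of [switch]; otherwise both vanish. *)
Lemma hard_env_independent b : independent_coordinates (noise (hard_env b)).
Proof.
move=> A mA; rewrite (bigD1 switch)//=.
have one (B : set (state hard_setting)) : (forall k, B (noise_tuple k)) ->
    atomic_prob noise_tuple sum_g B = 1%E.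
  move=> Bk; rewrite [LHS]atomicE -[in RHS]sum_g; congr EFin.
  by apply: eq_bigr => k _; rewrite indicE mem_set ?mulr1.
have zero (B : set (state hard_setting)) : (forall k, ~ B (noise_tuple k)) ->
    atomic_prob noise_tuple sum_g B = 0%E.
  move=> Bk; rewrite [LHS]atomicE; congr EFin.
  by apply: big1 => k _; rewrite indicE memNset ?mulr0.
have constE i : i != switch -> forall k, tnth (noise_tuple k) i = (i < d)%N%:R.
  by move=> /negbTE iv k; rewrite noise_tupleE iv mul0r addr0.
have [all_in|] := pselect (forall i, i != switch -> A i (i < d)%N%:R).
  rewrite big1 ?mule1; last first.
    by move=> i iv; apply: one => k /=; rewrite constE//; exact: all_in.
  rewrite [LHS]atomicE [RHS]atomicE; congr EFin; apply: eq_bigr => k _.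
  congr (_ * _); rewrite !indicE; congr (_%:R); congr nat_of_bool.
  apply/idP/idP; rewrite !inE/=; first by move/(_ switch).
  move=> As i; have [->//|iv] := eqVneq i switch.
  by rewrite constE//; exact: all_in.
move=> /existsNP[i /not_implyP[iv Ai]].
rewrite [RHS](_ : _ = 0%E); last first.
  rewrite (bigD1 i)//= [X in (_ * (X * _))%E]zero ?mul0e ?mule0// => k /=.
  by rewrite constE.
by apply: zero => k /= /(_ i); rewrite constE.
Qed.

Lemma hard_env_ae b (Q : set (state hard_setting)) :
  (forall k, (k < K.*2.+2)%N -> Q (noise_tuple k)) ->
  {ae noise (hard_env b), forall x, Q x}.
Proof.
by apply: ae_atomic => k; exact: measurable_tuple_set1.
Qed.

Lemma norm2_deviation b t a i :
  norm2 (col i (deviation (hard_env b) t a)) =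
  if i == ord_max then kappa t else 0.
Proof.
rewrite (@norm2_layered_col _ _ _ d0 _ (- (if i == ord_max then kappa t else 0))).
  rewrite normrN; have [->|_] := eqVneq i ord_max.
    by rewrite leq_pmull// ger0_norm//; case/andP: (kappa_le t).
  by rewrite normr0 if_same.
move=> j; rewrite [LHS]mxE [X in _ + X]mxE nominal_weightE !mxE.
by rewrite -mulrBr -mulrBl column_scale0 /column_scale addrAC subrr add0r.
Qed.

(** Only the reward column deviates, equally for all actions, so the maxima are attained at
    [ord_max] and at any action, here the empty one. *)
Lemma hard_env_budget b : budget_spent (hard_env b).
Proof.
rewrite /budget_spent/=; move: kappa_budget.
case: kd => [mc [kmc CE]|_].
  split.
    move=> t a i tT; rewrite norm2_deviation; case: ifP => // _.
    by have /andP[k0 _] := kappa_le t; exact: le_trans (kmc t).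
  rewrite CE /C_DF; congr (_ * _%:R); apply/eqP; rewrite eqn_leq.
  apply/andP; split; last first.
    apply/bigmax_leqP => i _; apply: leq_sum => t _.
    apply/bigmax_leqP => a _; rewrite norm2_deviation.
    by case: ifP => _; rewrite ?eqxx.
  apply: leq_trans (leq_bigmax ord_max); apply: leq_sum => t _.
  apply: leq_trans (leq_bigmax (finset.set0 : action hard_setting)).
  by rewrite norm2_deviation eqxx.
rewrite -sum_kappa /C_AD; apply/le_anti/andP; split.
  apply: le_trans (le_bigmax _ _ ord_max); apply: ler_sum => t _.
  apply: le_trans (le_bigmax _ _ (finset.set0 : action hard_setting)).
  by rewrite norm2_deviation eqxx.
have k0 t : 0 <= kappa t by case/andP: (kappa_le t).
apply: bigmax_le => [|i _]; first exact: sumr_ge0.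
apply: ler_sum => t _; apply: bigmax_le => // a _.
by rewrite norm2_deviation; case: ifP.
Qed.

Lemma hard_env_valid b : valid_environment (hard_env b).
Proof.
have /andP[s0 s1] := half_gap_itv.
split.
- exact: topological_layered.
- move=> i j; rewrite mxE column_scale0; split; last first.
    move=> ij; have -> : layered i j = true by exact: ij.
    have rdN0 : rd != 0 by rewrite gt_eqF ?rd_gt0.
    apply: mulf_neq0; first by rewrite /= oner_eq0.
    apply: mulf_neq0; last by rewrite invr_eq0.
    (* [half_gap <= 1 / 4] keeps the weight at the switch away from 0. *)
    by case: ifP => _ //; case: (b) => /=; rewrite ?expr0 ?expr1 ?gt_eqF//; lra.
  by apply: contraNT => /negbTE ij; rewrite [layered i j]ij mul0r.
- exact: weights_supported.
- by move=> t a _; exact: weights_supported.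
- move=> a i; rewrite nominal_weightE.
  rewrite (@norm2_layered_col _ _ _ d0 _
    (column_scale d L (switch_scale b a) 0 i)).
    2: by move=> j; rewrite mxE.
  case: ifP => // _; rewrite column_scale0.
  have /andP[c1 c2] := switch_scale_itv b a.
  by case: ifP => _; rewrite ger0_norm; lra.
- exact: hard_env_mean.
- exact: hard_env_subgaussian.
- exact: hard_env_independent.
- by apply: hard_env_ae => k kK; exact: noise_norm.
- move=> a; apply: hard_env_ae => k kK /=; rewrite sem_nominal.
  apply: state_bounded => //; rewrite lexx/=.
  by have /andP[k0 kq] := kappa_le 0; exact: le_trans kq.
- move=> t a _; apply: hard_env_ae => k kK; rewrite /= [sem _ _]sem_dev.
  exact: state_bounded.
- exact: hard_env_budget.
Qed.

End Instance.

(** * Regret *)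

Lemma powR_half_sqrt (R : realType) (d L : nat) : (0 < d)%N ->
  d%:R `^ (L%:R / 2 - 2) = Num.sqrt d%:R ^+ L / d%:R ^+ 2 :> R.
Proof.
move=> d0; rewrite powRD; last by rewrite pnatr_eq0 -lt0n d0 implybT.
rewrite powRN powR_mulrn//; congr (_ / _).
by rewrite mulrC powRrM powR12_sqrt// powR_mulrn ?sqrtr_ge0.
Qed.

Section Regret.
Variables (R : realType) (d L : nat) (q : R).
Variables (T : nat) (kd : budget_kind R) (C : R).
Hypotheses (d0 : (0 < d)%N) (L0 : (0 < L)%N) (T0 : (0 < T)%N).
Variables (K : nat) (g : nat -> R).
Hypothesis K_le : K.+1%:R <= 6 * @Num.sqrt R T%:R.
Hypothesis sum_g : \sum_(k < K.*2.+2) g k ^+ 2 = 1.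
Hypothesis sym_g : forall k, (k < K.*2.+2)%N -> g (K.*2.+1 - k)%N = g k.
Hypothesis affinity : forall t, (t <= T)%N ->
         3 / 4 <= (\sum_(k < K.*2.+1) g k * g k.+1) ^+ t.
Variable kappa : nat -> R.
Hypothesis kappa_le : forall t, 0 <= kappa t <= q.
Hypothesis sum_kappa : \sum_(t < T) kappa t = C.

Local Notation rd := (Num.sqrt d%:R : R).
Local Notation S := (hard_setting d L q T kd C).
Local Notation env := (@hard_env R d L q T kd C K g sum_g kappa).
Local Notation s := (half_gap R d K).

Variable pi : policy S.

(** The suboptimal interventions of [hard_env b], of scale [1 / 2 - half_gap]. *)
Let bad (b : bool) : set (action S) :=
  [set a : action S | (switch d L \in a) == b].

Let slope (x : R) : R := if L == 1%N then rd else rd ^+ L.-2 * (1 - x).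
Let offset (x : R) : R :=
  if L == 1%N then - (rd * x) else rd ^+ L.-2 * (1 - x) * (d%:R - 1).

Let reward_affine r x : node_value d L r x (L * d) = offset x + slope x * r.
Proof.
by rewrite reward_value// /offset /slope; case: ifP => _; ring.
Qed.

Let err b t : R := fine (run_law (env b) pi
  [set w | bad b (action_at (env b) t w)]).

Let err_itv b t : (t < T)%N -> 0 <= err b t <= 1.
Proof.
move=> tT; rewrite fine_ge0//= -lee_fin fineK; last first.
  by apply: fin_num_measure; exact: measurable_action_set.
by apply: probability_le1; exact: measurable_action_set.
Qed.

Lemma mu_hard b (a : action S) :
  mu (env b) a = (offset 0 + slope 0 * switch_scale K b a)%:E.
Proof.
rewrite /mu expectation_atomic; last first.
  by apply: (measurableT_comp (measurable_tnth _)); exact: measurable_sem.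
congr EFin.
under eq_bigr do rewrite [sem _ _]sem_nominal// tnth_mktuple reward_affine.
transitivity (\sum_(k < K.*2.+2)
  (g k ^+ 2 * (offset 0 + slope 0 * switch_scale K b a) +
   slope 0 / rd * (g k ^+ 2 * noise_atom R K k))).
  by apply: eq_bigr => k _; ring.
rewrite big_split/= -mulr_suml -mulr_sumr sum_g noise_centered//.
by rewrite mulr0 addr0 mul1r.
Qed.

Lemma expected_reward b t : (t < T)%N ->
  ('E_(run_law (env b) pi)[fun w => tnth (state_at (env b) t w) ord_max] =
  (offset (kappa t) + slope (kappa t) * (1 / 2 + s) -
   2 * s * slope (kappa t) * err b t)%:E)%E.
Proof.
(* The coordinate [switch] of the noise recovers the atom and is centered, since [switch] is not a
   source. *)
move=> tT; apply: (@expectation_affine _ S (env b) pi _ _ _ sum_g erefl t tT _ _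
  _ _ (slope (kappa t) / rd) (fun x => tnth x (switch d L))).
- exact: measurable_state_at.
- exact: measurable_tnth.
- rewrite -[RHS](noise_centered sym_g); apply: eq_bigr => k _.
  by rewrite noise_tupleE// switchE// ltnn eqxx add0r mul1r.
- by move=> k; exact: measurable_tuple_set1.
- move=> w k kK wk; rewrite /state_at -/(noise_at t w) [noise_at t w]wk.
  rewrite [sem _ _]sem_dev// tnth_mktuple reward_affine.
  rewrite noise_tupleE// switchE// ltnn eqxx add0r mul1r.
  rewrite /switch_scale indicE; case: ifP => /= h.
    by rewrite mem_set//=; ring.
  by rewrite memNset; [rewrite /=; ring|rewrite /bad/= h].
Qed.

(** Every action is bad in one of the environments, so in each round the two error probabilities sum
    to at least [3 / 4 * (3 / 4) - 1 / 4 = 5 / 16]; over the rounds, one environment collects at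
    least half. *)
Lemma sum_err : exists b, 5 / 32 * T%:R <= \sum_(t < T) err b t.
Proof.
have bad01 a : bad true a \/ bad false a.
  by rewrite /bad/=; case: (_ \in _); [left|right].
(* A shift by one atom of the noise compensates the difference of weights. *)
have dev01 t a :
    (forall k, sem (dev (env true) t a) (noise_tuple d L q T kd C K k.+1) =
               sem (dev (env false) t a) (noise_tuple d L q T kd C K k)) \/
    (forall k, sem (dev (env true) t a) (noise_tuple d L q T kd C K k) =
               sem (dev (env false) t a) (noise_tuple d L q T kd C K k.+1)).
  have step k : noise_atom R K k.+1 / rd = noise_atom R K k / rd + 2 * s.
    by rewrite /noise_atom /half_gap -natr1; ring.
  have shift (h x y : R) : h - x + (y + 2 * x) = h + x + y by ring.
  have [va|va] := boolP (switch d L \in a); [left|right] => k;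
    rewrite [LHS]sem_dev// [RHS]sem_dev// step /switch_scale.
    by rewrite va/= shift.
  by rewrite (negbTE va)/= shift.
have two t : (t < T)%N -> 5 / 16 <= err true t + err false t.
  move=> tT.
  have := @two_environments _ S (env true) (env false) pi _ _
    (noise_tuple d L q T kd C K) sum_g erefl erefl (bad true) (bad false)
    bad01 dev01 t tT.
  by apply: le_trans; have := affinity (ltnW tT); lra.
have : 5 / 16 * T%:R <= \sum_(t < T) err true t + \sum_(t < T) err false t.
  rewrite -big_split/= mulr_natr -[X in _ *+ X](card_ord T) -sumr_const.
  by apply: ler_sum => t _; exact: two.
have half (x y c : R) :
    5 / 16 * c <= x + y -> 5 / 32 * c <= x \/ 5 / 32 * c <= y.
  by have [|] := leP (5 / 32 * c) x; [left|right; lra].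
by case/half => h; [exists true|exists false].
Qed.

(** Both losses are obtained round by round. For [L >= 2] the loss of a round is [rd ^+ L.-2] times
    [2 * s * u + x * (d - 1 + (1 / 2 + s - 2 * s * u))], where [u] is the error probability and [x]
    the deviation. *)
Lemma regret_ge b : ((2 * s * slope 0 * (\sum_(t < T) err b t) +
   rd ^+ L / 4 * C)%:E <= expected_regret (env b) pi)%E.
Proof.
(* An optimal action avoids [switch] if [b] holds and contains it otherwise. *)
have [a scale_a] : exists a : action S, switch_scale K b a = 1 / 2 + s.
  by exists (if b then finset.set0 else finset.setT);
    rewrite /switch_scale; case: b; rewrite ?inE.
have mua : ((offset 0 + slope 0 * (1 / 2 + s))%:E <=
            \big[maxe/-oo]_(a : action S) mu (env b) a)%E.
  by rewrite -scale_a -mu_hard; exact: (le_bigmax _ _ a).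
rewrite /expected_regret.
under [X in (_ - X)%E]eq_bigr do rewrite expected_reward//.
rewrite sumEFin.
apply: (@le_trans _ _ ((T%:R)%:E * (offset 0 + slope 0 * (1 / 2 + s))%:E -
  (\sum_(t < T) (offset (kappa t) + slope (kappa t) * (1 / 2 + s) -
     2 * s * slope (kappa t) * err b t))%:E)%E); last first.
  by apply: leeB => //; apply: lee_wpmul2l => //; rewrite lee_fin.
have sum_cst (x : R) : T%:R * x = \sum_(t < T) x.
  by rewrite sumr_const card_ord mulr_natl.
rewrite -EFinM -EFinB lee_fin sum_cst.
rewrite -sumrB -sum_kappa !mulr_sumr -big_split/=; apply: ler_sum => t _.
have /andP[s0 s1] := half_gap_itv R d0 K.
have /andP[e0 e1] := err_itv b (ltn_ord t).
have /andP[k0 _] := kappa_le t.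
have rd1 := rd_ge1 R d0; have d1 : 1 <= d%:R :> R by rewrite ler1n.
set u := err b t in e0 e1 *; set x := kappa t in k0 *.
(* The mean scale stays above [1 / 4], so that lowering the reward column by [x] costs at least
   [rd ^+ L / 4 * x]. *)
have gap : 1 / 4 <= 1 / 2 + s - 2 * s * u by nra.
rewrite /slope /offset; case: (L) L0 => [//|[|l]] _ /=.
  have : 0 <= rd * x by rewrite mulr_ge0//; lra.
  rewrite expr1; lra.
have p0 : 0 <= rd ^+ l * x by rewrite mulr_ge0// exprn_ge0//; lra.
have -> : rd ^+ l.+2 = rd ^+ l * d%:R by rewrite -addn2 exprD sqr_rd.
have : 0 <= rd ^+ l * x * ((d%:R - 1) + (1 / 2 + s - 2 * s * u) - d%:R / 4).
  by rewrite mulr_ge0//; lra.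
lra.
Qed.

(** The statistical and the budget terms of [regret_ge] are both nonnegative, so their sum dominates
    the maximum. *)
Lemma regret_lower_bound : exists b,
  ((1 / 100 * (d%:R `^ (L%:R / 2 - 2) *
     Num.max (Num.sqrt T%:R) (d%:R ^+ 2 * C)))%:E
   <= expected_regret (env b) pi)%E.
Proof.
have [b sb] := sum_err; exists b; apply: le_trans (regret_ge b).
rewrite lee_fin.
rewrite powR_half_sqrt//.
have rd1 := rd_ge1 R d0; have d1 : 1 <= d%:R :> R by rewrite ler1n.
have sT0 : 0 < Num.sqrt T%:R :> R by rewrite sqrtr_gt0 ltr0n.
have sqT : Num.sqrt T%:R ^+ 2 = T%:R :> R by rewrite sqr_sqrtr.
have C0 : 0 <= C.
  by rewrite -sum_kappa sumr_ge0// => t _; case/andP: (kappa_le t).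
have p0 : 0 <= rd ^+ L by rewrite exprn_ge0//; lra.
have /andP[s0 s1] := half_gap_itv R d0 K.
(* For [L >= 2] the right side has exponent [L - 3] in [rd], against [L - 4] on the left; for
   [L = 1] it is 1. *)
have slope_ge : rd ^+ L / d%:R ^+ 2 <= slope 0 / rd.
  rewrite ler_pdivrMr ?exprn_gt0//; last lra.
  rewrite mulrAC ler_pdivlMr; last lra.
  have rdd : rd <= d%:R by rewrite -[leRHS](sqr_rd R d) expr2 ler_peMr//; lra.
  rewrite /slope subr0 mulr1; case: (L) L0 => [//|[|l]] _ /=.
    by rewrite expr1; nra.
  have -> : rd ^+ l.+2 = rd ^+ l * d%:R by rewrite -addn2 exprD sqr_rd.
  by rewrite -!mulrA ler_wpM2l ?exprn_ge0// expr2 ler_wpM2l//; lra.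
have slope0 : 0 <= slope 0 / rd.
  by apply: le_trans slope_ge; rewrite divr_ge0// exprn_ge0//; lra.
have mesh_ge : 1 / 24 / Num.sqrt T%:R <= mesh R K.
  have K0 : 0 < 4 * K.+1%:R :> R by rewrite mulr_gt0 ?ltr0n.
  by have K6 := K_le; rewrite /mesh mul1r -invfM lef_pV2 ?posrE//; lra.
(* The constants combine to [2 * (1 / 24) * (5 / 32) = 5 / 384], which exceeds [1 / 100]. *)
have stat : 1 / 100 * (rd ^+ L / d%:R ^+ 2) * Num.sqrt T%:R <=
    2 * s * slope 0 * \sum_(t < T) err b t.
  have -> : 2 * s * slope 0 * \sum_(t < T) err b t =
     (slope 0 / rd) * (2 * mesh R K * \sum_(t < T) err b t).
    by rewrite /half_gap; ring.
  rewrite [leLHS](_ : _ =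
    rd ^+ L / d%:R ^+ 2 * (1 / 100 * Num.sqrt T%:R)); last by ring.
  apply: ler_pM => //.
  apply: (@le_trans _ _ (2 * (1 / 24 / Num.sqrt T%:R) * (5 / 32 * T%:R))).
    have -> : 2 * (1 / 24 / Num.sqrt T%:R) * (5 / 32 * T%:R) =
        5 / 384 * Num.sqrt T%:R :> R.
      by rewrite -[X in 5 / 32 * X]sqT; field; rewrite gt_eqF.
    by lra.
  by apply: ler_pM => //; rewrite ler_pM2l.
apply: le_trans (lerD stat (lexx _)) => {stat sb}.
have pC : 0 <= rd ^+ L * C by rewrite mulr_ge0.
have pT : 0 <= 1 / 100 * (rd ^+ L / d%:R ^+ 2) * Num.sqrt T%:R.
  by rewrite !mulr_ge0 ?invr_ge0 ?exprn_ge0//; lra.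
have [_|_] := leP (Num.sqrt T%:R) (d%:R ^+ 2 * C); last by lra.
have -> : rd ^+ L / d%:R ^+ 2 * (d%:R ^+ 2 * C) = rd ^+ L * C.
  by rewrite mulrA divfK// expf_neq0// gt_eqF//; lra.
lra.
Qed.

End Regret.

(** The constants [c] and [b] are absolute and [m] depends on [d], [L] and [q] only, so the growth
    in [T] and [C] cannot come from rescaling the noise or the states. *)
Theorem corollary9 (R : realType) :
  exists c b : R, [/\ 0 < c, 0 < b &
  forall (d L : nat) (q : R), (0 < d)%N -> (0 < L)%N -> 0 <= q ->
  exists m : R,
  forall (T : nat) (k : budget_kind R) (C : R),
  (0 < T)%N -> attainable q T k C ->
  forall alg : algorithm R,
  exists (S : setting R) (I : environment S),
    [/\ [/\ degree (@edge R S) = d, has_length (@edge R S) L,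
            horizon S = T, kind S = k & budget S = C],
        noise_bound S = b * Num.sqrt d%:R /\ state_bound S = m,
        valid_environment I
      & ((c * (d%:R `^ (L%:R / 2 - 2) *
               Num.max (Num.sqrt T%:R) (d%:R ^+ 2 * C)))%:E
         <= expected_regret I (alg S))%E]].
Proof.
exists (1 / 100), 2; split; [lra|lra|move=> d L q d0 L0 _].
exists (state_norm_bound d L q) => T k C T0 att alg.
have [kappa [kq sumk bk]] := attainable_schedule T0 att.
have [K [g [K6 sum_g sym_g aff]]] := affinity_pmf R T0.
(* The setting is already determined; only the choice between its two environments depends on
   [alg]. *)
have [b regb] := regret_lower_bound d0 L0 T0 K6 sum_g sym_g aff kq sumk
  (alg (hard_setting d L q T k C)).
exists (hard_setting d L q T k C), (hard_env d L q T k C sum_g kappa b).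
split => //.
- split => //; [exact: degree_layered|exact: has_length_layered].
- exact: hard_env_valid.
Qed.
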